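(* Let $(X,d)$ be a finite tree-like pseudometric space with associated (unique, positively weighted) compatible split system $\mathcal S$, and let $r:=\operatorname{rk}(\cap\mathcal A(\mathcal S))$. Then the $f$-polynomial of the Lipschitz polytope is $$f^{\operatorname{LIP}(X,d)}(x)=(-x)^{r}\,M_{\mathcal A(\mathcal S)}\!\left(-\tfrac1x,-1\right)+x^{r+1}.$$ If moreover $d$ is a metric, then the $f$-polynomial of the fundamental polytope is $$f^{P_d(X)}(x)=(-1)^{r}\,M_{\mathcal A(\mathcal S)}(-x,-1)\,x+1 .$$
   Context: Notation for splits: $X$ finite, $n=|X|$, $\mathbbm 1_A:=\sum_{x\in A}\mathbbm 1_x$ in $\mathbb R^X$; a split $A|B$ is an unordered partition of $X$ into two nonempty blocks; $\delta_\sigma(i,j)=0$ if $i,j$ are on the same side of $\sigma$, else $1$; compatibility of $A|B$, $C|D$ means one of $A\cap C,A\cap D,B\cap C,B\cap D$ is empty. A pseudometric $d$ on $X$ is tree-like if it is the path-length metric $d(x,y)=d_w(\phi(x),\phi(y))$ of a tree $T$ with positive edge weights $w$ and a map $\phi:X\to V(T)$ whose image contains all vertices of degree $\le2$; equivalently (known), $d=\sum_{\sigma\in\mathcal S}\alpha_\sigma\delta_\sigma$ for a unique system $\mathcal S$ of pairwise compatible splits with all $\alpha_\sigma>0$. Polytopes: $\operatorname{LIP}(X,d):=\{x\in\mathbb R^X\mid\sum_i x_i=0,\ x_i-x_j\le d(i,j)\ \forall i,j\}$; for a metric $d$, $P_d(X):=\operatorname{conv}\{(\mathbbm 1_i-\mathbbm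 1_j)/d(i,j)\mid i\ne j\}$. For a polytope $P$ of dimension $m$ with $f_i^P$ faces of dimension $i$ ($f_{-1}^P=1$ for the empty face), $f^P(t):=f_{-1}^Pt^{m+1}+f_0^Pt^m+\dots+f_m^P$. Arrangement: let $V(\mathcal S):=\{x\in\mathbb R^X\mid\sum_ix_i=0,\ x_i=x_j\text{ whenever } d(i,j)=0\}$. For $\sigma=A|B\in\mathcal S$ let $v_\sigma:=\tfrac{|B|}{n}\mathbbm 1_A-\tfrac{|A|}{n}\mathbbm 1_B\in V(\mathcal S)$ and $H_\sigma:=\{x\in V(\mathcal S)\mid\langle x,v_\sigma\rangle=0\}$; $\mathcal A(\mathcal S):=\{H_\sigma\mid\sigma\in\mathcal S\}$, an arrangement of hyperplanes in $V:=V(\mathcal S)$, $m:=\dim V$. Its intersection poset $\mathscr L(\mathcal A)=\{\cap\mathcal B\mid\mathcal B\subseteq\mathcal A\}$ (with $\cap\emptyset=V$) is ordered by reverse inclusion and ranked by $\operatorname{rk}(x)=m-\dim x$; $\mu$ is its Möbius function. The Möbius polynomial is $M_{\mathcal A}(u,v):=\sum_{x,y\in\mathscr L(\mathcal A)}\mu(x,y)u^{\operatorname{rk}(x)}v^{r-\operatorname{rk}(y)}$ with $r=\operatorname{rk}(\cap\mathcal A)$.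
   Formalization: The formula for the fundamental polytope is stated for |X| ≥ 2; for |X| ≤ 1 the polytope P_d(X) is the convex hull of the empty set, with f-polynomial 1, while the right-hand side is x+1. *)

(* Defs.v *)
From HB Require Import structures.
From mathcomp Require Import all_boot all_order all_algebra.
Set Implicit Arguments. Unset Strict Implicit. Unset Printing Implicit Defensive.
Import Order.TTheory GRing.Theory Num.Theory.
Local Open Scope ring_scope.

Section Defs.
Variables (R : realFieldType) (n : nat).

(* A split A|B is represented by its block A (B = ~: A). *)
Definition delta (A : {set 'I_n}) (i j : 'I_n) : bool := (i \in A) != (j \in A).

(* A system of splits: each A is a proper nonempty block, and a split is
   not listed twice (A and ~:A are never both in S). *)
Definition split_system (S : {set {set 'I_n}}) : Prop :=
  forall A, A \in S -> [/\ A != set0, ~: A != set0 & ~: A \notin S].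

Definition compatible (A C : {set 'I_n}) : bool :=
  [|| A :&: C == set0, A :&: ~: C == set0, ~: A :&: C == set0 | ~: A :&: ~: C == set0].

Definition pairwise_compatible (S : {set {set 'I_n}}) : Prop :=
  forall A C, A \in S -> C \in S -> compatible A C.

Definition is_metric (d : 'I_n -> 'I_n -> R) : Prop :=
  forall i j, i != j -> 0 < d i j.

Definition evec (i : 'I_n) : 'rV[R]_n := \row_k (k == i)%:R.
Definition dot (c x : 'rV[R]_n) : R := \sum_i c 0 i * x 0 i.

Definition LIP (d : 'I_n -> 'I_n -> R) (x : 'rV[R]_n) : Prop :=
  \sum_i x 0 i = 0 /\ forall i j, x 0 i - x 0 j <= d i j.

Definition Pd (d : 'I_n -> 'I_n -> R) (x : 'rV[R]_n) : Prop :=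
  exists lam : 'I_n -> 'I_n -> R,
    [/\ forall i j, 0 <= lam i j, forall i, lam i i = 0,
        \sum_i \sum_j lam i j = 1 &
        x = \sum_i \sum_j lam i j *: ((d i j)^-1 *: (evec i - evec j))].

Definition affdim (P : 'rV[R]_n -> Prop) (k : int) : Prop :=
  (k = -1 /\ forall x, ~ P x) \/
  (exists m : nat, k = m%:Z /\
     (exists (p0 : 'rV[R]_n) (M : 'M[R]_(m, n)),
         [/\ P p0, forall i, P (p0 + row i M) & \rank M = m]) /\
     (forall (p0 : 'rV[R]_n) (m' : nat) (M : 'M[R]_(m', n)),
         P p0 -> (forall i, P (p0 + row i M)) -> (\rank M <= m)%N)).

(* faces: intersections with valid inequalities (includes empty face and P) *)
Definition is_face (P F : 'rV[R]_n -> Prop) : Prop :=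
  exists (c : 'rV[R]_n) (b : R),
    (forall y, P y -> dot c y <= b) /\ (forall y, F y <-> (P y /\ dot c y = b)).

Definition nfaces (P : 'rV[R]_n -> Prop) (k : int) (N : nat) : Prop :=
  exists Fs : 'I_N -> ('rV[R]_n -> Prop),
    [/\ forall i, is_face P (Fs i) /\ affdim (Fs i) k,
        forall i j, (forall x, Fs i x <-> Fs j x) -> i = j &
        forall F, is_face P F -> affdim F k -> exists i, forall x, F x <-> Fs i x].

Definition fvec (P : 'rV[R]_n -> Prop) (D : nat) (f : nat -> nat) : Prop :=
  affdim P (D%:Z - 1) /\ forall k, (k <= D)%N -> nfaces P (k%:Z - 1) (f k).

(* f^P(t) = sum_{i=-1}^{m} f_i t^{m-i}, with D = m+1 *)
Definition fpoly_val (D : nat) (f : nat -> nat) (t : R) : R :=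
  \sum_(k < D.+1) (f k)%:R * t ^+ (D - k).

(* subspaces of R^X are represented by square matrices (row spaces) *)
Definition flatV (d : 'I_n -> 'I_n -> R) : 'M[R]_n :=
  (kermx (const_mx 1 : 'M[R]_(n, 1)) :&:
   \bigcap_(p : 'I_n * 'I_n | d p.1 p.2 == 0) kermx (evec p.1 - evec p.2)^T)%MS.

Definition vsplit (A : {set 'I_n}) : 'rV[R]_n :=
  \row_i (if i \in A then #|~: A|%:R / n%:R else - (#|A|%:R / n%:R)).

Definition hyp (d : 'I_n -> 'I_n -> R) (A : {set 'I_n}) : 'M[R]_n :=
  (flatV d :&: kermx (vsplit A)^T)%MS.

(* cap B (cap of the empty family is V), canonical representative *)
Definition flat (d : 'I_n -> 'I_n -> R) (B : {set {set 'I_n}}) : 'M[R]_n :=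
  <<(flatV d :&: \bigcap_(A in B) hyp d A)>>%MS.

Definition Lposet (d : 'I_n -> 'I_n -> R) (S : {set {set 'I_n}}) : seq 'M[R]_n :=
  undup [seq flat d B | B <- enum (powerset S)].

Definition rk (d : 'I_n -> 'I_n -> R) (x : 'M[R]_n) : nat :=
  (\rank (flatV d) - \rank x)%N.

Definition rkA (d : 'I_n -> 'I_n -> R) (S : {set {set 'I_n}}) : nat :=
  rk d (flat d S).

(* Moebius function of L ordered by reverse inclusion: x <= y iff y \subset x.
   mu(x,x)=1, mu(x,y) = - sum_{x<=z<y} mu(x,z) if x<y, 0 otherwise.
   The fuel k = size L bounds the length of any strict chain in L. *)
Fixpoint mobf (L : seq 'M[R]_n) (k : nat) (x y : 'M[R]_n) : R :=
  if x == y then 1 else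
  match k with
  | 0 => 0
  | k'.+1 =>
      if (y <= x)%MS then
        - \sum_(z <- L | [&& (z <= x)%MS, (y <= z)%MS & z != y]) mobf L k' x z
      else 0
  end.

Definition mu (d : 'I_n -> 'I_n -> R) (S : {set {set 'I_n}}) (x y : 'M[R]_n) : R :=
  mobf (Lposet d S) (size (Lposet d S)) x y.

Definition Mob (d : 'I_n -> 'I_n -> R) (S : {set {set 'I_n}}) (u v : R) : R :=
  \sum_(x <- Lposet d S) \sum_(y <- Lposet d S)
     mu d S x y * u ^+ rk d x * v ^+ (rkA d S - rk d y).

End Defs.

(* Main.v *)
Require Import Defs.
From HB Require Import structures.
From mathcomp Require Import all_boot all_order all_algebra.
From mathcomp Require Import boolp zify ring lra.
Import Order.TTheory GRing.Theory Num.Theory.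
Local Open Scope ring_scope.

(* The Lipschitz polytope of a tree-like pseudometric is the zonotope
   sum_A alpha_A [-v_A, v_A]: remove a split having a side A of minimal cardinality (on
   which the points of LIP are constant) and choose the value on A for the remaining
   splits by Helly's theorem on the line.  Hence the faces of LIP correspond to the
   realized sign vectors of the arrangement, and the face of a sign vector s spans the
   v_A with s_A = 0.  The pairs (i, j) tight at the centre of that face span the
   orthogonal complement of these v_A, so that by polarity the proper faces of P_d
   correspond to the same sign vectors, in complementary dimension.  The sign vectors
   are counted by the Moebius function: the Euler relation
   sum_s (-1)^(dim s) = (-1)^(dim y) over the cells s contained in a flat y, proved by
   adding one hyperplane at a time, is inverted over the intersection poset. *)

Set Implicit Arguments. Unset Strict Implicit. Unset Printing Implicit Defensive.

(** * Orthogonality *)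

Section Dot.
Variables (R : realFieldType) (n : nat).
Implicit Types (c x y : 'rV[R]_n).

(** The [v A] may be linearly dependent: three points already carry three pairwise compatible splits
    in a plane. So LIP is in general not a parallelepiped, and a face cannot be given by an
    arbitrary choice of signs; only the sign patterns of actual linear functionals occur, which is
    why the count is one of cells. Functionals range over all row vectors, since only their values
    on the [v A] matter. A cell of codimension k yields a face of LIP of dimension k, so the rank of
    the span of the vanishing [v A] is the one statistic carried through the proof. For [Pd] no
    general duality of face lattices is invoked. A point [y] of LIP cuts the face [dot y x = 1]; one
    has to see that [y] can be moved to the centre of its smallest face without changing the cut
    (through a normal vector with the most nonzero signs), and that dimensions are complementary (by
    perturbing the centre inside LIP). The summands outside the Moebius polynomial are the faces
    without a sign vector: the empty face of LIP and the whole of [Pd]. *)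

Lemma dotE c x : dot c x = (c *m x^T) 0 0.
Proof. by rewrite /dot mxE; apply: eq_bigr => i _; rewrite mxE. Qed.

Lemma dotC c x : dot c x = dot x c.
Proof. by apply: eq_bigr => i _; rewrite mulrC. Qed.

Lemma dotDr c x y : dot c (x + y) = dot c x + dot c y.
Proof. by rewrite !dotE linearD mulmxDr mxE. Qed.

Lemma dotZr c (a : R) x : dot c (a *: x) = a * dot c x.
Proof. by rewrite !dotE linearZ -scalemxAr mxE. Qed.

Lemma dotNr c x : dot c (- x) = - dot c x.
Proof. by rewrite -scaleN1r dotZr mulN1r. Qed.

Lemma dotBr c x y : dot c (x - y) = dot c x - dot c y.
Proof. by rewrite dotDr dotNr. Qed.

Lemma dotDl c x y : dot (x + y) c = dot x c + dot y c.
Proof. by rewrite !(dotC _ c) dotDr. Qed.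

Lemma dotZl c (a : R) x : dot (a *: x) c = a * dot x c.
Proof. by rewrite !(dotC _ c) dotZr. Qed.

Lemma dot0l c : dot 0 c = 0.
Proof. by rewrite -(scale0r c) dotZl mul0r. Qed.

Lemma dot0r c : dot c 0 = 0.
Proof. by rewrite dotC dot0l. Qed.

Lemma dot_sumr (I : Type) (r : seq I) (P : pred I) c (F : I -> 'rV[R]_n) :
  dot c (\sum_(i <- r | P i) F i) = \sum_(i <- r | P i) dot c (F i).
Proof. by apply: (big_morph (dot c)); [exact: dotDr | exact: dot0r]. Qed.

Lemma dot_eq0 x : dot x x = 0 -> x = 0.
Proof.
move=> /eqP; rewrite psumr_eq0 => [/allP x0|i _]; last by rewrite -expr2 sqr_ge0.
apply/rowP => i; rewrite mxE; apply/eqP.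
by have := x0 i (mem_index_enum _); rewrite mulf_eq0 orbb.
Qed.

Lemma sub_perpP c x : reflect (dot c x = 0) (x <= kermx c^T)%MS.
Proof.
apply: (iffP sub_kermxP) => [h | h]; first by rewrite dotC dotE h mxE.
by apply/matrixP => i j; rewrite !ord1 -dotE dotC h mxE.
Qed.

Lemma dot_sub k (U : 'M[R]_(k, n)) c x :
  (x <= U)%MS -> (U <= kermx c^T)%MS -> dot c x = 0.
Proof. by move=> xU Uc; apply/sub_perpP/(submx_trans xU). Qed.

Lemma sub_kermx_tr k l (A : 'M[R]_(k, n)) (B : 'M[R]_(l, n)) :
  (A <= kermx B^T)%MS = (B <= kermx A^T)%MS.
Proof.
by rewrite !sub_kermx -(inj_eq (@trmx_inj _ _ _)) trmx_mul trmxK trmx0.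
Qed.

(** A vector of the row space killed by [W^T] is orthogonal to itself, hence zero: here the ordering
    of the field enters the linear algebra. *)
Lemma rank_mulmx_tr k (W : 'M[R]_(k, n)) : \rank (W *m W^T) = \rank W.
Proof.
have := mxrank_mul_ker W W^T; suff -> : (W :&: kermx W^T)%MS = 0.
  by rewrite mxrank0 addn0.
apply/eqP; rewrite -submx0; apply/row_subP => i; set x := row i _.
have : (x <= W :&: kermx W^T)%MS by apply: row_sub.
rewrite sub_capmx => /andP[xW]; rewrite sub_kermx_tr => Wx.
by rewrite (dot_eq0 (dot_sub xW Wx)) sub0mx.
Qed.

(** Rank-nullity for [V *m W^T], whose rank is that of [W]: with W = D V, the Gram matrix of [W]
    factors through it. *)
Lemma rank_perp k l (V : 'M[R]_(k, n)) (W : 'M[R]_(l, n)) :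
  (W <= V)%MS -> (\rank (V :&: kermx W^T) + \rank W = \rank V)%N.
Proof.
move=> WV; rewrite -(mxrank_mul_ker V W^T) addnC; congr addn; apply/eqP.
rewrite eqn_leq; apply/andP; split; last first.
  by rewrite -[leqRHS]mxrank_tr mxrankM_maxr.
case/submxP: WV => D ->; rewrite -[leqLHS]rank_mulmx_tr.
by rewrite -{1}mulmxA; apply: mxrankM_maxr.
Qed.

Lemma sep_notin k (U : 'M[R]_(k, n)) x : ~~ (x <= U)%MS ->
  exists2 w, (U <= kermx w^T)%MS & dot w x != 0.
Proof.
rewrite submxE => /eqP h.
have [j hj] : exists j, (x *m cokermx U) 0 j != 0.
  case: (boolP [exists j, (x *m cokermx U) 0 j != 0]) => [/existsP //|].
  move=> /existsPn h0; case: h.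
  by apply/rowP => j; rewrite [RHS]mxE; apply/eqP; move: (h0 j); rewrite negbK.
exists (col j (cokermx U))^T.
  by rewrite trmxK sub_kermx colE mulmxA mulmx_coker mul0mx.
by rewrite dotC dotE trmxK colE mulmxA -colE mxE.
Qed.

End Dot.

(** * Faces and affine dimension *)

Section Affdim.
Variables (R : realFieldType) (n : nat).
Implicit Types (P Q : 'rV[R]_n -> Prop).

Lemma affdim_uniq P (k l : int) : affdim P k -> affdim P l -> k = l.
Proof.
have ne m (M : 'M[R]_(m, n)) p0 : P p0 -> ~ (forall x, ~ P x) by move=> h /(_ p0).
case=> [[-> P0] | [m [-> [[p0 [M [Pp0 PM rM]] mx]]]]];
case=> [[-> Q0] | [m' [-> [[p0' [M' [Pp0' PM' rM']] mx']]]]] //.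
- by case: (P0 _ Pp0').
- by case: (Q0 _ Pp0).
congr Posz; apply/eqP; rewrite eqn_leq.
by rewrite -{1}rM (mx' _ _ _ Pp0 PM) -{1}rM' (mx _ _ _ Pp0' PM').
Qed.

Lemma affdim_ext P Q k : (forall x, P x <-> Q x) -> affdim P k -> affdim Q k.
Proof.
move=> PQ [[-> P0]|[m [-> [[p0 [M [Pp0 PM rM]] mx]]]]].
  by left; split=> // x /PQ /P0.
right; exists m; split=> //; split.
  by exists p0, M; split=> // [|i]; apply/PQ.
by move=> q0 m' N /PQ Pq PN; apply: mx Pq _ => i; apply/PQ.
Qed.

Lemma affdim_span P k (W : 'M[R]_(k, n)) p0 :
  P p0 -> (forall i, P (p0 + row i W)) ->
  (forall q, P q -> (q - p0 <= W)%MS) -> affdim P (\rank W)%:Z.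
Proof.
move=> Pp0 PW sW; right; exists (\rank W); split=> //; split.
  exists p0, (rowsub (maxrankfun W) W); split=> // [i|].
    by rewrite row_rowsub.
  by rewrite eq_maxrowsub.
move=> q0 m' M Pq PM; apply: mxrankS; apply/row_subP => i.
rewrite (_ : row i M = (q0 + row i M - p0) - (q0 - p0)).
  by rewrite addmx_sub ?eqmx_opp ?sW.
by rewrite opprB addrA subrK addrAC subrr add0r.
Qed.

(** Faces are predicates compared extensionally; a faithful indexing by a finite set turns their
    number into the cardinality of a set of sign vectors. *)
Lemma nfaces_card P k (T : finType) (Q : {set T}) (Phi : T -> 'rV[R]_n -> Prop) :
  (forall s, s \in Q -> is_face P (Phi s) /\ affdim (Phi s) k) ->
  {in Q &, forall s s', (forall x, Phi s x <-> Phi s' x) -> s = s'} ->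
  (forall F, is_face P F -> affdim F k ->
     exists2 s, s \in Q & forall x, F x <-> Phi s x) ->
  nfaces P k #|Q|.
Proof.
move=> h1 h2 h3; exists (fun i => Phi (enum_val i)); split.
- by move=> i; apply/h1/enum_valP.
- by move=> i j /h2 h; apply/enum_val_inj/h; apply: enum_valP.
move=> F /h3 h /h[s sQ hs]; exists (enum_rank_in sQ s) => x.
by rewrite enum_rankK_in.
Qed.

Lemma sum_card_fiber (T : finType) (Q : {set T}) (e : T -> nat) N (g : nat -> R) :
  {in Q, forall s, e s < N}%N ->
  \sum_(k < N) #|[set s in Q | e s == k]|%:R * g k = \sum_(s in Q) g (e s).
Proof.
move=> eN; transitivity (\sum_(k < N) \sum_(s in Q | e s == k) g (e s)).
  apply: eq_bigr => k _; rewrite (eq_bigr (fun=> g k)) => [|s /andP[_ /eqP->] //].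
  by rewrite sumr_const mulr_natl; congr (_ *+ _); apply: eq_card => s; rewrite !inE.
rewrite (exchange_big_dep (mem Q)) /= => [|k s _ /andP[] //].
apply: eq_bigr => s sQ; rewrite (big_pred1 (Ordinal (eN s sQ))) // => k.
by rewrite sQ /= eq_sym.
Qed.

End Affdim.

(** * The Euler relation of an arrangement *)

Section Arrangement.
Variables (R : realFieldType) (n : nat) (T : finType) (v : T -> 'rV[R]_n).
Implicit Types (B Sg : {set T}) (c x : 'rV[R]_n).

(** Signs live in a finite type so that sign vectors can be enumerated and summed over; [None] is
    the sign 0. *)
Definition sgb (a : R) : option bool := if a == 0 then None else Some (0 < a).

Definition vspan B : 'M[R]_n := (\sum_(a in B) <<v a>>)%MS.

(** The default [None] outside [Sg] gives the sign vectors of all subarrangements one type, so that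
    they can be compared when a hyperplane is added. *)
Definition cell Sg c : {ffun T -> option bool} :=
  [ffun a => if a \in Sg then sgb (dot c (v a)) else None].

Definition zeros Sg (s : {ffun T -> option bool}) := [set a in Sg | s a == None].

Definition realized Sg (s : {ffun T -> option bool}) : bool :=
  `[< exists c, s = cell Sg c >].

Lemma sgb0 a : (sgb a == None) = (a == 0).
Proof. by rewrite /sgb; case: (a == 0). Qed.

Lemma sgb_convex (a b p q : R) e :
  0 < p -> 0 < q -> sgb a = e -> sgb b = e -> sgb (p * a + q * b) = e.
Proof.
rewrite /sgb => p0 q0; case: eqP => [->|/eqP a0] <-.
  by case: eqP => // -> _; rewrite !mulr0 addr0 eqxx.
case: eqP => // /eqP b0 [ab]; case: (ltrgtP 0 a) ab a0 b0 => // ha + _ h.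
  move=> hb; have : 0 < p * a + q * b by rewrite addr_gt0 ?mulr_gt0.
  by case: ltrgtP.
move/negbT; rewrite -leNgt le_eqVlt (negPf h) /= => hb.
have : p * a + q * b < 0 by rewrite addrC; nra.
by case: ltrgtP.
Qed.

(* [eps] is the inverse of [1 + \sum |y a| / |x a|]; indices with [x a = 0] contribute 0. *)
Lemma small_step (I : finType) (x y : I -> R) :
  exists2 eps, 0 < eps & forall a, x a != 0 -> `|eps * y a| < `|x a|.
Proof.
pose Sm := \sum_a `|y a| / `|x a|.
have Sm0 : 0 <= Sm by apply: sumr_ge0 => a _; rewrite divr_ge0.
have S1 : 0 < 1 + Sm by rewrite ltr_wpDr.
exists (1 + Sm)^-1; first by rewrite invr_gt0.
move=> a xa; rewrite normrM gtr0_norm ?invr_gt0 // mulrC ltr_pdivrMr //.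
rewrite -ltr_pdivrMl ?normr_gt0 // mulrC.
have : `|y a| / `|x a| <= Sm.
  by rewrite /Sm (bigD1 a) //= lerDl sumr_ge0 // => b _; rewrite divr_ge0.
by move=> h; apply: (le_lt_trans h); rewrite ltrDr.
Qed.

Lemma sgb_perturb (a b : R) : `|b| < `|a| -> sgb (a + b) = sgb a.
Proof.
rewrite /sgb => h; have a0 : a != 0 by rewrite -normr_gt0 (le_lt_trans _ h).
rewrite (negPf a0); move: h; rewrite ltr_norml.
case: (ltrgtP 0 a) a0 => // ha _; rewrite ?(gtr0_norm ha) ?(ltr0_norm ha) => /andP[h1 h2].
  have : 0 < a + b by lra.
  by case: ltrgtP.
have : a + b < 0 by lra.
by case: ltrgtP.
Qed.

Lemma vspan_mem B a : a \in B -> (v a <= vspan B)%MS.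
Proof. by move=> aB; rewrite (sumsmx_sup a) ?genmxE. Qed.

Lemma vspan_subP B k (W : 'M[R]_(k, n)) :
  reflect (forall a, a \in B -> (v a <= W)%MS) (vspan B <= W)%MS.
Proof.
apply: (iffP sumsmx_subP) => h a /h; by rewrite genmxE.
Qed.

Lemma vspanS B B' : B \subset B' -> (vspan B <= vspan B')%MS.
Proof. by move/subsetP => BB; apply/vspan_subP => a /BB /vspan_mem. Qed.

Lemma vspan_perpP B c :
  reflect (forall a, a \in B -> dot c (v a) = 0) (vspan B <= kermx c^T)%MS.
Proof. by apply: (iffP (vspan_subP _ _)) => h a /h /sub_perpP. Qed.

Lemma rank_spanU1 B a : \rank (vspan (a |: B)) = (\rank (vspan B) + ~~ (v a <= vspan B)%MS)%N.
Proof.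
have [aB|aB] := boolP (v a <= vspan B)%MS; rewrite ?addn0 ?addn1.
  apply: eqmx_rank; apply/andP; split; last by rewrite vspanS ?subsetUr.
  by apply/vspan_subP => b; rewrite !inE => /predU1P[->//|/vspan_mem].
have e : (vspan (a |: B) :=: v a + vspan B)%MS.
  apply/eqmxP/andP; split.
    apply/vspan_subP => b; rewrite !inE => /predU1P[->|/vspan_mem h].
      exact: addsmxSl.
    exact: submx_trans h (addsmxSr _ _).
  by rewrite addsmx_sub vspan_mem ?setU11 // vspanS ?subsetUr.
rewrite e; have [w Bw /eqP wa] := sep_notin aB.
have va0 : v a != 0 by apply: contraNneq aB => ->; rewrite sub0mx.
rewrite mxrank_disjoint_sum ?rank_rV ?va0 ?add1n //.
apply/eqP; rewrite -submx0; apply/row_subP => i; set x := row i _.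
have : (x <= v a :&: vspan B)%MS by apply: row_sub.
rewrite sub_capmx => /andP[/sub_rVP[k ->]] /dot_sub /(_ Bw).
by rewrite dotZr => /eqP; rewrite mulf_eq0 (introF eqP wa) orbF => /eqP->; rewrite scale0r sub0mx.
Qed.

Lemma zeros_cell Sg c a : (a \in zeros Sg (cell Sg c)) = (a \in Sg) && (dot c (v a) == 0).
Proof. by rewrite !inE ffunE; case: (a \in Sg); rewrite //= sgb0. Qed.

Lemma realizedP Sg s : reflect (exists c, s = cell Sg c) (realized Sg s).
Proof. exact: asboolP. Qed.

Lemma zeros_perp Sg c : (vspan (zeros Sg (cell Sg c)) <= kermx c^T)%MS.
Proof. by apply/vspan_perpP => a; rewrite zeros_cell => /andP[_ /eqP]. Qed.

Lemma eq_cellP Sg c c' :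
  (forall a, a \in Sg -> sgb (dot c (v a)) = sgb (dot c' (v a))) ->
  cell Sg c = cell Sg c'.
Proof. by move=> h; apply/ffunP => a; rewrite !ffunE; case: ifP => // /h. Qed.

Section AddHyperplane.
Variables (Sg : {set T}) (a : T).
Hypothesis aSg : a \notin Sg.

Definition upd (s : {ffun T -> option bool}) (e : option bool) : {ffun T -> option bool} :=
  [ffun b => if b == a then e else s b].

Lemma cellU1 c : cell (a |: Sg) c = upd (cell Sg c) (sgb (dot c (v a))).
Proof.
by apply/ffunP => b; rewrite !ffunE !inE; case: eqP => //= ->.
Qed.

Lemma upd_cellK c e : upd (upd (cell Sg c) e) None = cell Sg c.
Proof. by apply/ffunP => b; rewrite !ffunE; case: eqP => // ->; rewrite (negPf aSg). Qed.

Lemma realized_updP s e : realized Sg s ->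
  reflect (exists2 c, s = cell Sg c & e = sgb (dot c (v a)))
    (realized (a |: Sg) (upd s e)).
Proof.
move=> rs; apply: (iffP (realizedP _ _)) => [[c]|[c -> ->]].
  case/realizedP: rs => c0 s0; rewrite cellU1 => /ffunP h; exists c; last by have := h a; rewrite !ffunE eqxx.
  rewrite s0; apply/ffunP => b; move: (h b); rewrite s0 !ffunE.
  by case: eqP => // ->; rewrite (negPf aSg).
by exists c; rewrite cellU1.
Qed.

Lemma zeros_upd s e :
  zeros (a |: Sg) (upd s e) = if e == None then a |: zeros Sg s else zeros Sg s.
Proof.
apply/setP => b; rewrite !inE; case: ifP => he; rewrite !inE !ffunE;
case: eqP => [->|] //=; rewrite ?he // (negPf aSg) //.
Qed.

(* A cell meeting the new hyperplane transversally splits into three cells, one of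
   them of codimension one higher, so the alternating count does not change. *)
Lemma euler_step s : realized Sg s ->
  \sum_(e | realized (a |: Sg) (upd s e))
     (-1) ^+ \rank (vspan (zeros (a |: Sg) (upd s e)))
  = (-1) ^+ \rank (vspan (zeros Sg s)) :> R.
Proof.
move=> rs; set W := vspan (zeros Sg s).
have split3 (F : option bool -> R) (P : pred (option bool)) :
  \sum_(e | P e) F e = (if P None then F None else 0)
     + ((if P (Some true) then F (Some true) else 0)
     + (if P (Some false) then F (Some false) else 0)).
  rewrite big_mkcond (bigD1 None) //= (bigD1 (Some true)) //= (bigD1 (Some false)) //=.
  by rewrite big1 ?addr0 // => -[[]|].
rewrite split3 !zeros_upd /= rank_spanU1 -/W.
have [c0 s0] := realizedP _ _ rs.
have perpW c : s = cell Sg c -> (W <= kermx c^T)%MS.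
  by move=> sc; rewrite /W sc zeros_perp.
(* First case: the hyperplane of [a] contains the whole cell, so only the entry [None] is possible
   and the rank does not grow. *)
have [aW|aW] := boolP (v a <= W)%MS; rewrite ?addn0 ?addn1.
  have z c : s = cell Sg c -> dot c (v a) = 0 by move/perpW; apply: dot_sub.
  have -> : realized (a |: Sg) (upd s None).
    by apply/(realized_updP _ rs); exists c0; rewrite // z // /sgb eqxx.
  have nr b : realized (a |: Sg) (upd s (Some b)) = false.
    apply/negP => /(realized_updP _ rs)[c /z ->].
    by rewrite /sgb eqxx.
  by rewrite !nr !addr0.
(* Second case: the hyperplane cuts the cell at [c1]. Moving by [eps] both ways along [w],
   orthogonal to [W] but not to [v a], realizes both strict signs; the three terms are -1, 1 and 1
   times the old one. *)
have [[c1 s1 c1a]|nz] := pselect (exists2 c, s = cell Sg c & dot c (v a) = 0).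
  have -> : realized (a |: Sg) (upd s None).
    by apply/(realized_updP _ rs); exists c1; rewrite // c1a /sgb eqxx.
  have [w Ww wa] := sep_notin aW.
  have [eps eps0 small] := small_step (fun b => dot c1 (v b)) (fun b => dot w (v b)).
  have cellw (u : R) : `|u| = eps -> s = cell Sg (c1 + u *: w).
    move=> ue; rewrite s1; apply: eq_cellP => b bS; rewrite dotDl dotZl.
    have [b0|b0] := eqVneq (dot c1 (v b)) 0.
      have bW : (v b <= W)%MS by rewrite vspan_mem // s1 zeros_cell bS b0 eqxx.
      by rewrite (dot_sub bW Ww) mulr0 addr0.
    rewrite sgb_perturb // normrM ue.
    by have := small b b0; rewrite normrM (gtr0_norm eps0).
  have r b : realized (a |: Sg) (upd s (Some b)).
    apply/(realized_updP _ rs).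
    pose u := if b == (0 < dot w (v a)) then eps else - eps.
    have ue : `|u| = eps by rewrite /u; case: ifP; rewrite ?normrN gtr0_norm.
    exists (c1 + u *: w); first exact: cellw.
    rewrite dotDl c1a add0r dotZl /sgb mulf_eq0 (negPf wa) orbF.
    have -> : (u == 0) = false.
      by rewrite -normr_eq0 ue gt_eqF.
    congr Some; apply/esym; rewrite /u; move: wa.
    case: (ltrgtP 0 (dot w (v a))) => // h _; case: b {cellw u ue} => /=;
      first [by apply/idP; nra | by apply/negbTE; rewrite -leNgt; nra].
  by rewrite !r exprS; ring.
(* Last case: the cell misses the hyperplane and hence lies strictly on one side of it, so a single
   term survives. *)
have -> : realized (a |: Sg) (upd s None) = false.
  apply/negP => /(realized_updP _ rs)[c sc /esym/eqP]; rewrite sgb0 => /eqP ca.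
  by apply: nz; exists c.
have r0 : realized (a |: Sg) (upd s (sgb (dot c0 (v a)))).
  by apply/(realized_updP _ rs); exists c0.
have c0a : sgb (dot c0 (v a)) != None.
  by rewrite sgb0; apply/eqP => h; apply: nz; exists c0.
suff nr : ~~ (realized (a |: Sg) (upd s (Some true)) &&
              realized (a |: Sg) (upd s (Some false))).
  case: (sgb _) r0 c0a nr => // -[] -> _; rewrite /= add0r ?andbT.
    by move=> /negPf ->; rewrite addr0.
  by move=> /negPf ->; rewrite add0r.
apply/negP => /andP[/(realized_updP _ rs)[c2 s2 +]].
rewrite {1}/sgb; case: eqP => // _ [/esym c2p].
move=> /(realized_updP _ rs)[c3 s3]; rewrite {1}/sgb; case: eqP => // /eqP c3n0 [/esym/negbT].
rewrite -leNgt le_eqVlt (negPf c3n0) /= => c3n.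
(* Both weights are positive and make the value at [v a] cancel; by convexity the combination stays
   in the cell, contradicting [nz]. *)
apply: nz; exists ((- dot c3 (v a)) *: c2 + dot c2 (v a) *: c3); last first.
  by rewrite dotDl !dotZl; ring.
rewrite s2; apply: eq_cellP => b bS; rewrite dotDl !dotZl.
apply/esym/sgb_convex; rewrite ?oppr_gt0 //.
have := s3; rewrite s2 => /ffunP/(_ b); rewrite !ffunE bS => ->; by [].
Qed.

End AddHyperplane.

(** This is the Euler characteristic of the linear space orthogonal to [B], written with
    codimensions of its cells. Induction on the number of hyperplanes outside [B]; with none left,
    only the zero sign vector remains. *)
Lemma euler_relation B Sg : B \subset Sg ->
  \sum_(s | realized Sg s && (B \subset zeros Sg s)) (-1) ^+ \rank (vspan (zeros Sg s))
  = (-1) ^+ \rank (vspan B) :> R.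
Proof.
move: {-2}(#|_|) (erefl #|Sg :\: B|) => k; elim: k Sg => [|k IH] Sg hk BS.
  have -> : Sg = B.
    by apply/eqP; rewrite eqEsubset BS andbT -setD_eq0 -cards_eq0 -hk.
  rewrite (big_pred1 [ffun=> None]) => [|s].
    by congr (_ ^+ \rank (vspan _)); apply/setP => b; rewrite !inE ffunE eqxx andbT.
  apply/andP/eqP => [[/realizedP[c ->] /subsetP h]|->].
    apply/ffunP => b; rewrite !ffunE; case: ifP => // /h.
    by rewrite zeros_cell -sgb0 => /andP[_ /eqP].
  split.
    by apply/realizedP; exists 0; apply/ffunP => b; rewrite !ffunE dot0l /sgb eqxx if_same.
  by apply/subsetP => b bB; rewrite !inE ffunE bB eqxx.
have /card_gt0P[a] : (0 < #|Sg :\: B|)%N by rewrite -hk.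
rewrite inE => /andP[aB aS]; pose Sg' := Sg :\ a.
have aS' : a \notin Sg' by rewrite !inE eqxx.
have BS' : B \subset Sg'.
  by apply/subsetP => b bB; rewrite !inE (subsetP BS) // andbT; apply: contraNneq aB => <-.
have SE : Sg = a |: Sg' by rewrite setD1K.
rewrite -(IH Sg') //; last first.
  have := cardsD1 a (Sg :\: B); rewrite -hk !inE aB aS add1n => -[->].
  by congr #|pred_of_set _|; rewrite /Sg' !setDDl setUC.
(* Cells are grouped by the cell of the smaller arrangement that contains them; inside a group only
   the entry at [a] varies, and [euler_step] sums the group. *)
rewrite SE (partition_big (fun s => upd a s None)
   (fun s => realized Sg' s && (B \subset zeros Sg' s))) /=; last first.
  move=> s /andP[/realizedP[c ->] h]; rewrite cellU1 // upd_cellK //.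
  apply/andP; split; first by apply/realizedP; exists c.

  apply/subsetP => b bB; have := subsetP h b bB; rewrite !zeros_cell (subsetP BS' b bB).
  by case/andP.
apply: eq_bigr => s /andP[rs Bs]; rewrite -(euler_step aS' rs).
have sa : s a = None.
  by case/realizedP: rs => c ->; rewrite ffunE (negPf aS').
rewrite (reindex_onto (upd a s) (fun s' => s' a)) /=; last first.
  move=> s' /andP[_ /eqP <-]; apply/ffunP => b; rewrite !ffunE.
  by case: eqP => // ->.
apply: eq_bigl => e; have -> : upd a s e a = e by rewrite ffunE eqxx.
rewrite eqxx andbT.
have -> : (upd a (upd a s e) None == s) = true.
  by apply/eqP/ffunP => b; rewrite !ffunE; case: eqP => // ->.
rewrite andbT; case: (realized _ _) => //=.
apply: subset_trans Bs _; rewrite zeros_upd //; case: ifP => // _.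
exact: subsetUr.
Qed.

End Arrangement.

(** * Moebius inversion *)

Section Moebius.
Variables (R : realFieldType) (n : nat).
Variable L : seq 'M[R]_n.
Hypothesis L_anti : {in L &, forall x y, (x <= y)%MS -> (y <= x)%MS -> x = y}.

Definition below (x y : 'M[R]_n) : pred 'M[R]_n :=
  fun z => [&& (z <= x)%MS, (y <= z)%MS & z != y].

(** The recursion depth is bounded by the number of flats of the interval other than [y]; passing to
    such a [z] lowers this number because [z] itself drops out. Hence one unit of fuel can be added
    before unfolding. *)
Lemma mobf_fuel k l x y : x \in L -> y \in L ->
  (count (below x y) L <= k)%N -> (count (below x y) L <= l)%N ->
  mobf L k x y = mobf L l x y.
Proof.
elim: k l x y => [|k IH] [|l] x y xL yL //=.
- rewrite leqn0 => /eqP c0 _; case: eqP => // _; case: ifP => // _.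
  rewrite big_hasC ?oppr0 //; rewrite has_count c0 //.
- move=> _; rewrite leqn0 => /eqP c0; case: eqP => // _; case: ifP => // _.
  rewrite big_hasC ?oppr0 //; rewrite has_count c0 //.
move=> ck cl; case: eqP => // _; case: ifP => // yx; congr (- _).
rewrite big_seq_cond [RHS]big_seq_cond; apply: eq_bigr => z /and4P[zL zx yz zy].
have lt : (count (below x z) L < count (below x y) L)%N.
  have := count_predC (pred1 z) [seq w <- L | below x y w].
  rewrite size_filter => <-; rewrite -[(count _ L).+1]add1n leq_add // -?has_count.
    apply/hasP; exists z; rewrite /= ?eqxx // mem_filter zL andbT.
    by rewrite /below zx yz zy.
  rewrite count_filter.
  rewrite (@eq_in_count _ (below x z) [pred w | (w \in L) && below x z w]) => [|w /= ->//].
  apply: sub_count => w /=; rewrite /below => /and4P[wL wx zw wz].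
  rewrite wx (submx_trans yz zw) wz /=.
  by apply: contraNneq zy => wy; apply/eqP/L_anti; rewrite // -wy.
by apply: IH => //; rewrite -ltnS (leq_trans lt).
Qed.

Let m x y := mobf L (size L) x y.

Lemma mobf_rec x y : x \in L -> y \in L -> x != y -> (y <= x)%MS ->
  m x y = - \sum_(z <- L | below x y z) m x z.
Proof.
move=> xL yL xy yx; rewrite /m (@mobf_fuel _ (size L).+1) ?count_size ?leqW ?count_size //=.
by rewrite (negPf xy) yx.
Qed.

Lemma mobf_out x y : ~~ (y <= x)%MS -> m x y = 0.
Proof.
move=> yx; rewrite /m; case: (size L) => [|k] /=; rewrite ?(negPf yx); case: eqP => // xy;
  by rewrite xy submx_refl in yx.
Qed.

Lemma mobf_diag x : m x x = 1.
Proof. by rewrite /m; case: (size L) => [|k] /=; rewrite eqxx. Qed.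

Lemma mobf_interval x w : uniq L -> x \in L -> w \in L ->
  \sum_(y <- L | (w <= y)%MS) m x y = (x == w)%:R.
Proof.
move=> uL xL wL.
have [wx|wx] := boolP (w <= x)%MS; last first.
  rewrite big1 => [|y wy]; first by case: eqP wx => // ->; rewrite submx_refl.
  by apply/mobf_out/negP => yx; rewrite (submx_trans wy yx) in wx.
rewrite (bigID (fun y => (y <= x)%MS)) /= [X in _ + X]big1 ?addr0; last first.
  by move=> y /andP[_]; apply: mobf_out.
rewrite -big_filter (bigD1_seq w) ?filter_uniq ?mem_filter ?wx ?wL ?submx_refl //=.
rewrite big_filter_cond (eq_bigl (below x w)) => [|y]; last first.
  by rewrite /below; case: (w <= y)%MS; case: (y <= x)%MS; case: (y != w).
have [<-|xw] := eqVneq x w; last by rewrite mobf_rec // addNr.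
rewrite mobf_diag big_seq_cond big1 ?addr0 // => y /and4P[yL yx xy].
by rewrite (L_anti yL xL yx xy) eqxx.
Qed.

(** After exchanging the sums, each [s] carries the sum of the Moebius function over the interval
    from [x] to [fl s], which is 1 if [fl s = x] and 0 otherwise. *)
Lemma moebius_inversion (I : finType) (Q : pred I) (fl : I -> 'M[R]_n) (g : I -> R)
    (h : 'M[R]_n -> R) x :
  uniq L -> x \in L -> (forall s, Q s -> fl s \in L) ->
  (forall y, y \in L -> \sum_(s | Q s && (fl s <= y)%MS) g s = h y) ->
  \sum_(y <- L) m x y * h y = \sum_(s | Q s && (fl s == x)) g s.
Proof.
move=> uL xL flL gh.
transitivity (\sum_(y <- L) \sum_(s | Q s) (if (fl s <= y)%MS then m x y * g s else 0)).
  by apply: eq_big_seq => y yL; rewrite -gh // mulr_sumr big_mkcondr.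
rewrite exchange_big /= [RHS]big_mkcondr; apply: eq_bigr => s Qs.
rewrite -big_mkcond -mulr_suml mobf_interval ?flL // eq_sym.
by case: eqP; rewrite ?mul1r ?mul0r.
Qed.

End Moebius.

(** * The Moebius polynomial *)

Section Flats.
Variables (R : realFieldType) (n : nat) (d : 'I_n -> 'I_n -> R).
Variable S : {set {set 'I_n}}.
Local Notation v := (@vsplit R n).
Local Notation V := (flatV d).
Local Notation L := (Lposet d S).
Hypothesis SV : forall A, A \in S -> (v A <= V)%MS.
Implicit Types (B : {set {set 'I_n}}).

Lemma sub_flat k (M : 'M[R]_(k, n)) B :
  (M <= flat d B)%MS = (M <= V)%MS && (M <= kermx (vspan v B)^T)%MS.
Proof.
rewrite genmxE sub_capmx; have [MV|//] := boolP (M <= V)%MS; rewrite /=.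
rewrite [RHS]sub_kermx_tr; apply/sub_bigcapmxP/vspan_subP => h A /h.
  by rewrite sub_capmx MV /= sub_kermx_tr.
by rewrite sub_capmx MV /= sub_kermx_tr.
Qed.

Lemma flat_subV B : (flat d B <= V)%MS.
Proof. by have := submx_refl (flat d B); rewrite sub_flat => /andP[]. Qed.

Lemma flat_perp B : (flat d B <= kermx (vspan v B)^T)%MS.
Proof. by have := submx_refl (flat d B); rewrite sub_flat => /andP[]. Qed.

Lemma flatS B B' : B' \subset B -> (flat d B <= flat d B')%MS.
Proof.
move=> BB; rewrite sub_flat flat_subV /= sub_kermx_tr.
by apply: submx_trans (vspanS _ BB) _; rewrite -sub_kermx_tr flat_perp.
Qed.

Lemma flatI B B' : (flat d B :&: flat d B' :=: flat d (B :|: B'))%MS.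
Proof.
apply/eqmxP/andP; split.
  rewrite sub_flat (submx_trans (capmxSl _ _) (flat_subV B)) /= sub_kermx_tr.
  have := submx_trans (capmxSr (flat d B) _) (flat_perp B').
  rewrite sub_kermx_tr => /vspan_subP h2.
  have := submx_trans (capmxSl _ (flat d B')) (flat_perp B).
  rewrite sub_kermx_tr => /vspan_subP h1.
  by apply/vspan_subP => A; rewrite inE => /orP[/h1|/h2].
by rewrite sub_capmx !flatS ?subsetUl ?subsetUr.
Qed.

Lemma vspan_sub_flatV B : B \subset S -> (vspan v B <= V)%MS.
Proof. by move=> /subsetP BS; apply/vspan_subP => A /BS/SV. Qed.

Lemma rank_flat B : B \subset S ->
  (\rank (flat d B) + \rank (vspan v B) = \rank V)%N.
Proof.
move=> BS; rewrite -(rank_perp (vspan_sub_flatV BS)); congr addn.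
apply: eqmx_rank; apply/andP; split.
  by rewrite sub_capmx flat_subV flat_perp.
by rewrite sub_flat capmxSl capmxSr.
Qed.

Lemma rk_flat B : B \subset S -> rk d (flat d B) = \rank (vspan v B).
Proof. by move=> BS; rewrite /rk -(rank_flat BS) addKn. Qed.

Lemma rkAE : rkA d S = \rank (vspan v S).
Proof. exact: rk_flat. Qed.

Lemma rank_span_le B : B \subset S -> (\rank (vspan v B) <= rkA d S)%N.
Proof. by move=> BS; rewrite rkAE mxrankS ?vspanS. Qed.

Lemma mem_Lposet B : B \subset S -> flat d B \in L.
Proof. by move=> BS; rewrite mem_undup map_f // mem_enum inE. Qed.

Lemma LposetP y : y \in L -> exists2 B : {set {set 'I_n}}, B \subset S & y = flat d B.
Proof.
by rewrite mem_undup => /mapP[B]; rewrite mem_enum inE => BS ->; exists B.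
Qed.

Lemma Lposet_anti : {in L &, forall x y, (x <= y)%MS -> (y <= x)%MS -> x = y}.
Proof.
move=> x y /LposetP[B _ ->] /LposetP[B' _ ->]; rewrite /flat !genmxE => h1 h2.
by apply/genmxP; rewrite h1.
Qed.

Lemma zeros_sub s : zeros S s \subset S.
Proof. by apply/subsetP => A; rewrite inE => /andP[]. Qed.

(** The zero set of a realized sign vector is closed: a functional vanishing on it vanishes on its
    span, so every split of [S] whose vector lies in that span already belongs to it. Equality of
    ranks puts the vectors of [B] in the span. *)
Lemma flat_zeros_sub s B : B \subset S -> realized v S s ->
  (flat d (zeros S s) <= flat d B)%MS = (B \subset zeros S s).
Proof.
move=> BS /realizedP[c sc]; set Z := zeros S s.
have ZS : Z \subset S by apply: zeros_sub.
apply/idP/idP => [ZB|BZ]; last first.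
  exact: flatS.
have ZBS : Z :|: B \subset S by rewrite subUset ZS.
have rkE : \rank (vspan v (Z :|: B)) = \rank (vspan v Z).
  apply/eqP; rewrite -(eqn_add2l (\rank (flat d Z))) rank_flat //.
  by rewrite -(capmx_idPl ZB) flatI rank_flat.
have h : (vspan v (Z :|: B) <= vspan v Z)%MS.
  by rewrite -(geq_leqif (mxrank_leqif_sup (vspanS v (subsetUl Z B)))) rkE.
apply/subsetP => A AB; rewrite /Z sc zeros_cell (subsetP BS A AB) /=.
apply/eqP/(@dot_sub _ _ _ (vspan v Z)); last by rewrite /Z sc zeros_perp.
by apply: submx_trans h; rewrite vspan_mem // inE AB orbT.
Qed.

Lemma sign_subK (a b : nat) : (a <= b)%N -> (-1) ^+ (b - a) = (-1) ^+ b * (-1) ^+ a :> R.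
Proof.
by move=> ab; rewrite -[in RHS](subnK ab) exprD -mulrA -expr2 sqrr_sign mulr1.
Qed.

(** At v = -1 the factor v^(r - rk y) is (-1)^r (-1)^(rk y), and (-1)^(rk y) is the Euler sum over
    the cells inside y. Inversion leaves the cells whose flat is exactly x, each with sign (-1)^(rk
    x), which merges with u^(rk x). *)
Lemma Mob_eval (u : R) :
  Mob d S u (-1) =
  (-1) ^+ rkA d S * \sum_(s | realized v S s) (- u) ^+ \rank (vspan v (zeros S s)).
Proof.
have rkL y : y \in L -> (rk d y <= rkA d S)%N.
  by case/LposetP => B BS ->; rewrite rk_flat ?rank_span_le.
have rkz s : rk d (flat d (zeros S s)) = \rank (vspan v (zeros S s)).
  by rewrite rk_flat ?zeros_sub.
have inner x : x \in L -> \sum_(y <- L) mu d S x y * (-1) ^+ rk d y =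
    \sum_(s | realized v S s && (flat d (zeros S s) == x)) (-1) ^+ \rank (vspan v (zeros S s)).
  move=> xL; apply: moebius_inversion => //.
  - exact: Lposet_anti.
  - exact: undup_uniq.
  - by move=> s _; apply/mem_Lposet/zeros_sub.
  move=> _ /LposetP[B BS ->]; rewrite rk_flat // -(euler_relation v BS).
  by apply: eq_bigl => s; case: (boolP (realized _ _ _)) => //= rs; rewrite flat_zeros_sub.
rewrite /Mob mulr_sumr.
transitivity (\sum_(x <- L) \sum_(s | realized v S s && (flat d (zeros S s) == x))
  (-1) ^+ rkA d S * (- u) ^+ \rank (vspan v (zeros S s))).
  apply: eq_big_seq => x xL.
  transitivity ((-1) ^+ rkA d S * u ^+ rk d x * \sum_(y <- L) mu d S x y * (-1) ^+ rk d y).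
    rewrite mulr_sumr; apply: eq_big_seq => y yL.
    rewrite sign_subK ?rkL //.
    by move: (mu _ _ _ _) (u ^+ _) (_ ^+ rkA d S) (_ ^+ rk d y) => *; ring.
  rewrite inner // mulr_sumr; apply: eq_bigr => s /andP[_ /eqP sx].
  by rewrite -sx rkz -mulrA -exprMn mulrN1.
rewrite (exchange_big_dep (realized v S)) /= => [|x s _ /andP[]//].
apply: eq_bigr => s rs; rewrite big_mkcond.
rewrite (bigD1_seq (flat d (zeros S s))) ?undup_uniq ?mem_Lposet ?zeros_sub //=.
rewrite rs eqxx /= big1 ?addr0 // => x /negPf xs.
by rewrite eq_sym xs.
Qed.

End Flats.

(** * The Lipschitz polytope as a zonotope *)

Section Zonotope.
Variables (R : realFieldType) (n : nat).
Variable alpha : {set 'I_n} -> R.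
Local Notation v := (@vsplit R n).
Implicit Types (A C : {set 'I_n}) (S : {set {set 'I_n}}) (y : 'rV[R]_n).

(** The metric as a function of the split system, since the induction for the zonotope removes
    splits one by one. *)
Definition splitd S (i j : 'I_n) : R := \sum_(A in S) alpha A * (delta A i j)%:R.

Definition zonotope S y : Prop :=
  exists2 a : {set 'I_n} -> R,
    forall A, A \in S -> `|a A| <= alpha A & y = \sum_(A in S) a A *: v A.

(** In this form [v A] is the indicator of [A] projected to sum zero, so its coordinate differences
    are those of the indicator. *)
Lemma vsplitE A i : v A 0 i = (i \in A)%:R - #|A|%:R / n%:R.
Proof.
have n0 : n%:R != 0 :> R by case: n i => [[]//|k] _; rewrite pnatr_eq0.
rewrite mxE; case: (i \in A); rewrite ?sub0r //=.
have := cardsC A; rewrite card_ord => /(congr1 (fun k => k%:R : R)).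
rewrite natrD => E; apply: (mulIf n0); rewrite mulrBl !mulfVK // -E.
by rewrite mul1r addrAC subrr add0r.
Qed.

Lemma vsplitC A : v (~: A) = - v A.
Proof. by apply/rowP => i; rewrite !mxE inE setCK; case: (i \in A); rewrite ?opprK. Qed.

Lemma sum_vsplit A : \sum_i v A 0 i = 0.
Proof.
have [n0|n0] := posnP n.
  by rewrite big1 // => i _; have := ltn_ord i; rewrite {2}n0.
under eq_bigr => i _ do rewrite vsplitE.
rewrite sumrB sumr_const card_ord -natr_sum -big_mkcond /= sum1_card.
by rewrite -[X in _ - X]mulr_natr mulfVK ?subrr // pnatr_eq0 -lt0n.
Qed.

Lemma deltaC A : delta (~: A) =2 delta A.
Proof. by move=> i j; rewrite /delta !inE; case: (i \in A); case: (j \in A). Qed.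

Lemma delta_sym A i j : delta A i j = delta A j i.
Proof. by rewrite /delta eq_sym. Qed.

Lemma vsplitB A i j : v A 0 i - v A 0 j = (i \in A)%:R - (j \in A)%:R.
Proof. by rewrite !vsplitE; ring. Qed.

Section Metric.
Variable S : {set {set 'I_n}}.
Hypothesis alpha0 : forall A, A \in S -> 0 <= alpha A.

Lemma splitd_sym i j : splitd S i j = splitd S j i.
Proof. by apply: eq_bigr => A _; rewrite delta_sym. Qed.

Lemma splitd_ge0 i j : 0 <= splitd S i j.
Proof. by apply: sumr_ge0 => A AS; rewrite mulr_ge0 ?alpha0. Qed.

Lemma splitd_triangle i j k : splitd S i k <= splitd S i j + splitd S j k.
Proof.
rewrite -big_split /=; apply: ler_sum => A AS; rewrite -mulrDr ler_wpM2l ?alpha0 //.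
rewrite /delta -natrD ler_nat.
by case: (i \in A); case: (j \in A); case: (k \in A).
Qed.

Lemma splitd_eq0 i j : (forall A, A \in S -> delta A i j = false) -> splitd S i j = 0.
Proof. by move=> h; apply: big1 => A /h ->; rewrite mulr0. Qed.

End Metric.

Lemma compatibleC A C : compatible (~: A) C = compatible A C.
Proof.
rewrite /compatible setCK; do 4 case: (_ == set0) => //.
Qed.

(** Compatibility puts [A] inside a side of [C], or a side of [C] inside [A]; in the latter case the
    cardinalities force equality. Either way [C] does not separate points of [A]. *)
Lemma minimal_side A C : compatible A C -> (#|A| <= #|C|)%N -> (#|A| <= #|~: C|)%N ->
  {in A &, forall i j, delta C i j = false}.
Proof.
have sub (B : {set 'I_n}) : (A \subset B) || (A == ~: B) || (A \subset ~: B) || (A == B) ->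
  {in A &, forall i j, delta B i j = false}.
  move=> + i j iA jA; rewrite /delta => /orP[/orP[/orP[]|]|].
  - by move/subsetP => h; rewrite !h.
  - by move/eqP => E; move: iA jA; rewrite E !inE => /negPf-> /negPf->.
  - by move/subsetP => h; move: (h i iA) (h j jA); rewrite !inE => /negPf-> /negPf->.
  - by move/eqP <-; rewrite iA jA.
move=> cAC AC AC'; apply: sub; case/or4P: cAC.
- by rewrite setI_eq0 disjoints_subset => ->; rewrite orbT.
- by rewrite setI_eq0 disjoints_subset setCK => ->.
- rewrite setI_eq0 disjoints_subset setCS => CA.
  have /eqP -> : C == A by rewrite eqEcard CA.
  by rewrite eqxx !orbT.
- rewrite setIC setI_eq0 disjoints_subset setCK => CA.
  have /eqP -> : ~: C == A by rewrite eqEcard CA.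
  by rewrite eqxx !orbT.
Qed.

Lemma LIP_zonotope S y :
  (forall A, A \in S -> 0 <= alpha A) ->
  (forall A, A \in S -> A != set0 /\ ~: A != set0) ->
  pairwise_compatible S ->
  LIP (splitd S) y -> zonotope S y.
Proof.
move: {-2}(#|_|) (erefl #|S|) => k; elim: k S y => [|k IH] S y.
  move=> /esym/cards0_eq -> _ _ _ [y0 yd]; exists (fun=> 0) => [A|]; first by rewrite inE.
  rewrite big_set0; apply/rowP => i; rewrite mxE.
  have yi j : y 0 j = y 0 i.
    have := yd i j; have := yd j i; rewrite !splitd_eq0 => [|A|A]; rewrite ?inE // !subr_le0.
    by move=> ? ?; apply/eqP; rewrite eq_le; apply/andP.
  move: y0; rewrite (eq_bigr (fun=> y 0 i)) // sumr_const card_ord => /eqP.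
  rewrite mulrn_eq0 => /orP[/eqP n0|/eqP//].
  by have := ltn_ord i; rewrite {2}n0.
move=> Sk a0 Sne pc [y0 yd].
have [A1 A1S] : exists A1, A1 \in S by apply/card_gt0P; rewrite -Sk.
(* [S] lists one block per split, but the minimum must run over both blocks; [sg] is the listed
   block of the chosen split and [w] the sign relating the two vectors. *)
pose side (A : {set 'I_n}) := (A \in S) || (~: A \in S).
have sA1 : side A1 by rewrite /side A1S.
case: (arg_minnP (fun A : {set 'I_n} => #|A|) sA1) => A sA minA.
pose sg := if A \in S then A else ~: A.
have sgS : sg \in S by rewrite /sg; move: sA; rewrite /side; case: ifP.
have dsg i j : delta sg i j = delta A i j by rewrite /sg; case: ifP => // _; rewrite deltaC.
pose w : R := if A \in S then 1 else -1.
have w1 : w = 1 \/ w = -1 by rewrite /w; case: ifP; [left|right].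
have vA : v A = w *: v sg.
  rewrite /w /sg; case: ifP => _; first by rewrite scale1r.
  by rewrite vsplitC scaleN1r opprK.
have /set0Pn[i0 i0A] : A != set0.
  by move: sA => /orP[] /Sne[]; rewrite ?setCK.
have inA C : C \in S -> {in A &, forall i j, delta C i j = false}.
  move=> CS; apply: minimal_side.
  - by move: sA => /orP[] h; [|rewrite -compatibleC]; apply: pc.
  - by apply: minA; rewrite /side CS.
  - by apply: minA; rewrite /side setCK CS orbT.
pose S' := S :\ sg; pose d' := splitd S'.
have dE i j : splitd S i j = alpha sg * (delta A i j)%:R + d' i j.
  by rewrite /d' /splitd (big_setD1 sg) //= dsg.
have S'S C : C \in S' -> C \in S by rewrite inE => /andP[].
have a0' C : C \in S' -> 0 <= alpha C by move/S'S/a0.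
have d'A i j : i \in A -> j \in A -> d' i j = 0.
  by move=> iA jA; apply: splitd_eq0 => C /S'S CS; apply: inA.
have d's := @splitd_sym S'; have d't := splitd_triangle a0'.
have d'0 := splitd_ge0 a0'; rewrite -/d' in d's d't d'0.
have asg := a0 _ sgS.
have in_out i j : i \in A -> j \notin A -> splitd S i j = alpha sg + d' i0 j.
  move=> iA jA; rewrite dE /delta iA (negPf jA) mulr1; congr (_ + _).
  apply/eqP; rewrite eq_le; have := d't i i0 j; have := d't i0 i j.
  by rewrite (d'A i i0) // (d'A i0 i) // !add0r => -> ->.
have dsym i j : splitd S i j = splitd S j i by apply: splitd_sym.
pose a := y 0 i0.
have yA i : i \in A -> y 0 i = a.
  move=> iA; have := yd i i0; have := yd i0 i.
  rewrite !dE !d'A // /delta i0A iA mulr0 addr0 !subr_le0 /a => ? ?.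
  by apply/eqP; rewrite eq_le; apply/andP.
(* Helly in dimension one: the new common value [t] on [A] is the largest lower bound. *)
pose t := \big[Num.max/a - alpha sg]_(j | j \notin A) (y 0 j - d' i0 j).
have t1 : a - alpha sg <= t by apply: bigmax_ge_id.
have t2 j : j \notin A -> y 0 j - d' i0 j <= t.
  by move=> jA; apply: (le_bigmax_cond _ (fun j => y 0 j - d' i0 j)).
(* Every lower bound must lie below every upper bound. Bounds from [a] and from a point outside [A]
   compare by the LIP inequality across the split; two outside points compare by their own LIP
   inequality and the triangle inequality through [i0]. *)
have t3 : t <= a + alpha sg.
  apply: bigmax_le => [|j jA]; first by lra.
  by have := yd j i0; rewrite dsym in_out // -/a; lra.
have t4 k' : k' \notin A -> t <= y 0 k' + d' i0 k'.
  move=> kA; apply: bigmax_le => [|j jA].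
    by have := yd i0 k'; rewrite in_out // -/a; lra.
  have := yd j k'; rewrite dE /delta (negPf jA) (negPf kA) mulr0 add0r.
  by have := d't j i0 k'; rewrite (d's j i0); lra.
(* Up to a constant vector, this only moves the value on [A] from [a] to [t]; using [v A] keeps the
   sum zero. By [t1] and [t3] the coefficient is at most [alpha sg] in absolute value. *)
pose y' := y - (a - t) *: v A.
have y'E i j : y' 0 i - y' 0 j =
    y 0 i - y 0 j - (a - t) * ((i \in A)%:R - (j \in A)%:R).
  by rewrite -vsplitB !mxE; ring.
have [] := IH S' y'.
- by move: Sk; rewrite (cardsD1 sg) sgS => -[].
- exact: a0'.
- by move=> C /S'S/Sne.
- by move=> C D /S'S CS /S'S DS; apply: pc.
- split.
    transitivity (\sum_i (y 0 i - (a - t) * v A 0 i)).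
      by apply: eq_bigr => i _; rewrite !mxE.
    by rewrite sumrB y0 -mulr_sumr sum_vsplit mulr0 subr0.
  move=> i j; rewrite y'E -/(d' i j).
  case: (boolP (i \in A)) => iA; case: (boolP (j \in A)) => jA /=.
  + by rewrite !yA // d'A //; lra.
  + have := in_out i j iA jA; rewrite dE /delta iA (negPf jA) mulr1 => /addrI ->.
    by rewrite yA //; have := t2 j jA; have := t4 j jA; lra.
  + have := in_out j i jA iA; rewrite dsym dE /delta jA (negPf iA) mulr1 => /addrI ->.
    by rewrite (yA j) //; have := t2 i iA; have := t4 i iA; lra.
  + have := yd i j; rewrite dE /delta (negPf iA) (negPf jA) mulr0; lra.
move=> b b1 yb; exists (fun C => if C == sg then (a - t) * w else b C) => [C CS|].
  case: eqP => [->|/eqP Csg]; last by apply: b1; rewrite !inE Csg.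
  rewrite normrM (_ : `|w| = 1) ?mulr1; last by case: w1 => ->; rewrite ?normrN normr1.
  by rewrite ler_norml; apply/andP; split; lra.
rewrite (big_setD1 sg) //= eqxx.
rewrite (eq_bigr (fun C => b C *: v C)) => [|C]; last by rewrite !inE => /andP[/negPf->].
by rewrite -yb -scalerA -vA addrC subrK.
Qed.

Lemma zonotope_LIP S y : zonotope S y -> LIP (splitd S) y.
Proof.
case=> a a1 ->; split.
  under eq_bigr => i _ do rewrite summxE.
  rewrite exchange_big /= big1 // => A AS.
  by under eq_bigr => i _ do rewrite mxE; rewrite -mulr_sumr sum_vsplit mulr0.
move=> i j; rewrite !summxE -sumrB; apply: ler_sum => A AS.
rewrite !mxE -[X in X <= _]mulrBr -/(v A).
have := a1 A AS; rewrite ler_norml => /andP[h1 h2].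
have := vsplitB A i j; rewrite !mxE => ->.
by rewrite /delta; case: (i \in A); case: (j \in A) => /=; lra.
Qed.

End Zonotope.

Lemma affdim_family (R : realFieldType) (n : nat) (T : finType) (g : T -> 'rV[R]_n)
    (P : 'rV[R]_n -> Prop) (Z : {set T}) p0 :
  P p0 -> (forall a, a \in Z -> P (p0 + g a)) ->
  (forall q, P q -> (q - p0 <= vspan g Z)%MS) ->
  affdim P (\rank (vspan g Z))%:Z.
Proof.
move=> Pp0 Pg sg; pose W := \matrix_(i < #|Z|) g (enum_val i).
have rW i : row i W = g (enum_val i) by rewrite rowK.
have ZW : (vspan g Z <= W)%MS.
  apply/vspan_subP => a aZ.
  by rewrite -(enum_rankK_in aZ aZ) -rW row_sub.
have WZ : (W <= vspan g Z)%MS.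
  by apply/row_subP => i; rewrite rW vspan_mem // enum_valP.
have -> : \rank (vspan g Z) = \rank W by apply: eqmx_rank; rewrite ZW.
apply: affdim_span Pp0 _ _ => [i|q /sg h]; first by rewrite rW; apply/Pg/enum_valP.
exact: submx_trans h ZW.
Qed.

Lemma eq_of_eq_sum (R : realFieldType) (T : finType) (S : {set T}) (F G : T -> R) :
  (forall A, A \in S -> F A <= G A) -> \sum_(A in S) F A = \sum_(A in S) G A ->
  forall A, A \in S -> F A = G A.
Proof.
move=> FG E A AS; apply/eqP; rewrite eq_sym -subr_eq0; apply/eqP.
apply: (@psumr_eq0P R T (mem S) (fun A => G A - F A)) => //= [B BS|].
  by rewrite subr_ge0 FG.
by rewrite sumrB E subrr.
Qed.

Definition sv (R : realFieldType) (e : option bool) : R :=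
  if e is Some b then (if b then 1 else -1) else 0.
Arguments sv {R} e.

Lemma sv_inj (R : realFieldType) : injective (@sv R).
Proof. by move=> [[]|] [[]|] //= h; exfalso; lra. Qed.

Lemma sv_sgb (R : realFieldType) (x : R) : sv (sgb x) * x = `|x|.
Proof.
rewrite /sgb; case: eqP => [->|/eqP x0] /=; first by rewrite normr0 mulr0.
by case: (ltrgtP 0 x) x0 => // h _; rewrite ?(gtr0_norm h) ?(ltr0_norm h) ?mul1r ?mulN1r.
Qed.

Lemma norm_sv (R : realFieldType) e : `|sv e : R| <= 1.
Proof. by case: e => [[]|] /=; rewrite ?normrN ?normr1 ?normr0 ?ler01. Qed.

Lemma mulr_norm_eq (R : realFieldType) (a al x : R) : x != 0 ->
  a * x = al * `|x| -> a = al * sv (sgb x).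
Proof.
move=> x0; rewrite -sv_sgb mulrA => h; exact: (mulIf x0).
Qed.

Section FlatV.
Variables (R : realFieldType) (n : nat) (d : 'I_n -> 'I_n -> R).
Implicit Types (x y : 'rV[R]_n).

Lemma dot_evec y i : dot y (evec R i) = y 0 i.
Proof.
rewrite /dot (bigD1 i) //= mxE eqxx mulr1 big1 ?addr0 // => k /negPf ki.
by rewrite mxE ki mulr0.
Qed.

Lemma flatVP x :
  (x <= flatV d)%MS <-> (\sum_i x 0 i = 0 /\ forall i j, d i j = 0 -> x 0 i = x 0 j).
Proof.
have E : (x <= kermx (const_mx 1 : 'M[R]_(n, 1)))%MS <-> \sum_i x 0 i = 0.
  have e : (x *m (const_mx 1 : 'M[R]_(n, 1))) 0 0 = \sum_i x 0 i.
    by rewrite mxE; apply: eq_bigr => i _; rewrite mxE mulr1.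
  split=> [/sub_kermxP h|h]; first by rewrite -e h mxE.
  by apply/sub_kermxP/matrixP => i j; rewrite !ord1 e h mxE.
rewrite sub_capmx; split=> [/andP[/E h /sub_bigcapmxP hp]|[/E -> h]] /=.
  split=> // i j dij; have /sub_perpP := hp (i, j) (introT eqP dij).
  by rewrite dotC dotBr !dot_evec => /eqP; rewrite subr_eq0 => /eqP.
apply/sub_bigcapmxP => -[i j] /= /eqP dij; apply/sub_perpP.
by rewrite dotC dotBr !dot_evec (h _ _ dij) subrr.
Qed.

End FlatV.

(** * Faces of the Lipschitz polytope *)

Section LipFaces.
Variables (R : realFieldType) (n : nat) (d : 'I_n -> 'I_n -> R).
Variables (alpha : {set 'I_n} -> R) (S : {set {set 'I_n}}).
Local Notation v := (@vsplit R n).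
Local Notation V := (flatV d).
Local Notation r := (rkA d S).
Local Notation sign := {ffun {set 'I_n} -> option bool}.
Local Notation Z s := (zeros S s).
Hypothesis alpha_gt0 : forall A, A \in S -> 0 < alpha A.
Hypothesis Sne : forall A, A \in S -> A != set0 /\ ~: A != set0.
Hypothesis pc : pairwise_compatible S.
Hypothesis dE : forall i j, d i j = splitd alpha S i j.
Implicit Types (c x y w : 'rV[R]_n) (s : sign) (a : {set 'I_n} -> R).

Let alpha_ge0 A : A \in S -> 0 <= alpha A.
Proof. by move/alpha_gt0/ltW. Qed.

Lemma LIP_zonotopeP y : LIP d y <-> zonotope alpha S y.
Proof.
have -> : LIP d y <-> LIP (splitd alpha S) y.
  by split=> -[y0 yd]; split=> // i j; have := yd i j; rewrite dE.
by split; [apply: LIP_zonotope | apply: zonotope_LIP].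
Qed.

(** The maximum of [dot c] over the zonotope: each segment contributes independently. *)
Definition support_fun c : R := \sum_(A in S) alpha A * `|dot c (v A)|.

Definition sface s y : Prop :=
  exists2 a, forall A, A \in S ->
      `|a A| <= alpha A /\ (s A != None -> a A = alpha A * sv (s A))
    & y = \sum_(A in S) a A *: v A.

(** The free coefficients are 0, strictly inside their intervals; this makes the point relatively
    interior to [sface s]. *)
Definition center s : 'rV[R]_n := \sum_(A in S) (alpha A * sv (s A)) *: v A.

Lemma dot_comb c a : dot c (\sum_(A in S) a A *: v A) = \sum_(A in S) a A * dot c (v A).
Proof. by rewrite dot_sumr; apply: eq_bigr => A _; rewrite dotZr. Qed.

Lemma term_le (b al t : R) : `|b| <= al -> b * t <= al * `|t|.
Proof.
move=> h; apply: le_trans (ler_norm _) _; rewrite normrM ler_wpM2r //.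
Qed.

Lemma dot_LIP_le c y : LIP d y -> dot c y <= support_fun c.
Proof.
case/LIP_zonotopeP => a a1 ->; rewrite dot_comb; apply: ler_sum => A AS.
exact/term_le/a1.
Qed.

(** Each term is bounded by its own maximum, so the sum is maximal only if every term is; a
    coefficient is then forced exactly where [c] does not vanish. *)
Lemma dot_comb_max c a : (forall A, A \in S -> `|a A| <= alpha A) ->
  dot c (\sum_(A in S) a A *: v A) = support_fun c <->
  (forall A, A \in S -> cell v S c A != None -> a A = alpha A * sv (cell v S c A)).
Proof.
move=> a1; rewrite dot_comb; split=> [h A AS|h].
  rewrite ffunE AS sgb0 => cA; apply: mulr_norm_eq => //.
  by apply: (eq_of_eq_sum (F := fun A => a A * dot c (v A)) _ h AS) => B BS; apply/term_le/a1.
apply: eq_bigr => A AS; have := h A AS; rewrite ffunE AS sgb0.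
have [-> _|c0 ->//] := eqVneq (dot c (v A)) 0; first by rewrite normr0 !mulr0.
by rewrite -mulrA sv_sgb.
Qed.

Lemma sfaceP c y : sface (cell v S c) y <-> (LIP d y /\ dot c y = support_fun c).
Proof.
split=> [[a ha ->]|[/LIP_zonotopeP[a a1 ->]]].
  split; first by apply/LIP_zonotopeP; exists a => // A /ha[].
  by apply/dot_comb_max => A AS; case: (ha A AS).
by move=> /dot_comb_max h; exists a => // A AS; split; [apply: a1 | apply: h].
Qed.

Lemma norm_alpha_sv A e : A \in S -> `|alpha A * sv e| <= alpha A.
Proof.
move=> AS; rewrite normrM (gtr0_norm (alpha_gt0 AS)).
by rewrite ler_piMr ?alpha_ge0 ?norm_sv.
Qed.

Lemma center_sface s : sface s (center s).
Proof. by exists (fun A => alpha A * sv (s A)) => // A AS; rewrite norm_alpha_sv. Qed.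

Lemma sface_LIP s y : sface s y -> LIP d y.
Proof. by case=> a ha ->; apply/LIP_zonotopeP; exists a => // A /ha[]. Qed.

Lemma center_LIP s : LIP d (center s).
Proof. exact: sface_LIP (center_sface s). Qed.

Lemma dot_center c : dot c (center (cell v S c)) = support_fun c.
Proof. by have [] := (sfaceP c _).1 (center_sface _). Qed.

Lemma center_max c s : dot c (center s) = support_fun c ->
  forall A, A \in S -> cell v S c A != None -> s A = cell v S c A.
Proof.
move=> h A AS cA; apply: (@sv_inj R); apply: (mulfI (lt0r_neq0 (alpha_gt0 AS))).
have a1 B : B \in S -> `|alpha B * sv (s B)| <= alpha B by apply: norm_alpha_sv.
exact: (dot_comb_max c a1).1 h A AS cA.
Qed.

(** By [center_max] each sign vector agrees with the other on the support of that other, so they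
    coincide. This separates faces both for LIP and for [Pd]. *)
Lemma center_max_inj s s' : realized v S s -> realized v S s' ->
  (forall c, s = cell v S c -> dot c (center s') = support_fun c) ->
  (forall c, s' = cell v S c -> dot c (center s) = support_fun c) -> s = s'.
Proof.
move=> /realizedP[c sc] /realizedP[c' sc'] /(_ c sc)/center_max h /(_ c' sc')/center_max h'.
rewrite -sc in h; rewrite -sc' in h'; apply/ffunP => A.
have [AS|AS] := boolP (A \in S); last by rewrite sc sc' !ffunE (negPf AS).
have := h A AS; have := h' A AS; case: (s A) => [b|]; case: (s' A) => [b'|] //.
- by move=> _ ->.
- by move=> _ ->.
by move=> ->.
Qed.

Lemma sface_shift s A (e : bool) : A \in Z s ->
  sface s (center s + (if e then 1 else -1) *: (alpha A *: v A)).
Proof.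
rewrite inE => /andP[AS /eqP sA].
pose u : R := if e then 1 else -1.
exists (fun B => if B == A then u * alpha A else alpha B * sv (s B)) => [B BS|].
  case: eqP => [->|_]; last by rewrite norm_alpha_sv.
  rewrite sA; split=> //; rewrite normrM (gtr0_norm (alpha_gt0 AS)).
  by rewrite /u; case: (e); rewrite ?normrN normr1 mul1r.
rewrite /center !(big_setD1 A AS) /= eqxx sA mulr0 scale0r add0r addrC scalerA.
by congr (_ + _); apply: eq_bigr => B; rewrite !inE => /andP[/negPf->].
Qed.

Lemma sface_diff s y y' : sface s y -> sface s y' -> (y - y' <= vspan v (Z s))%MS.
Proof.
case=> a ha -> [a' ha' ->]; rewrite -sumrB; apply: summx_sub => A AS.
rewrite -scalerBl; have [sA|sA] := boolP (s A == None).
  by rewrite scalemx_sub // vspan_mem // inE AS.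
by rewrite (ha A AS).2 // (ha' A AS).2 // subrr scale0r sub0mx.
Qed.

Lemma affdim_sface s : affdim (sface s) (\rank (vspan v (Z s)))%:Z.
Proof.
have E : (vspan (fun A => alpha A *: v A) (Z s) :=: vspan v (Z s))%MS.
  apply/eqmxP/andP; split; apply/vspan_subP => A AZ.
    by rewrite scalemx_sub ?vspan_mem.
  have AS : A \in S by move: AZ; rewrite inE => /andP[].
  rewrite -[v A]scale1r -(mulVf (lt0r_neq0 (alpha_gt0 AS))) -scalerA scalemx_sub //.
  exact: (@vspan_mem _ _ _ (fun A => alpha A *: v A)).
rewrite -E; apply: (@affdim_family _ _ _ _ _ _ (center s)).
- exact: center_sface.
- by move=> A /(sface_shift true); rewrite scale1r.
by move=> q hq; rewrite E; apply: sface_diff hq (center_sface s).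
Qed.

Lemma zeros_cell0 : Z (cell v S 0) = S.
Proof. by apply/setP => A; rewrite zeros_cell dot0l eqxx andbT. Qed.

Lemma LIP_sface0 y : sface (cell v S 0) y <-> LIP d y.
Proof.
have s0 : support_fun 0 = 0 by apply: big1 => A _; rewrite dot0l normr0 mulr0.
by split=> [/sfaceP[]//|h]; apply/sfaceP; rewrite dot0l s0.
Qed.

Lemma LIP_face F k : is_face (LIP d) F -> affdim F k%:Z ->
  exists2 s, realized v S s & forall x, F x <-> sface s x.
Proof.
move=> [c [b [hb hF]]] aF.
have [y0 /hF[y0L y0b]] : exists y, F y.
  by case: aF => [[]//|[m [_ [[p0 [M [h _ _]]] _]]]]; exists p0.
have bs : b = support_fun c.
  apply/eqP; rewrite eq_le -{1}y0b dot_LIP_le //= -dot_center hb //.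
  exact: center_LIP.
exists (cell v S c); first by apply/realizedP; exists c.
by move=> y; rewrite hF sfaceP bs.
Qed.

Lemma splitd_symm i j : d i j = d j i.
Proof. by rewrite !dE splitd_sym. Qed.

Lemma LIP_flatV y : LIP d y -> (y <= V)%MS.
Proof.
move=> [y0 yd]; apply/flatVP; split=> // i j dij.
have := yd i j; have := yd j i; rewrite splitd_symm dij !subr_le0 => ? ?.
by apply/eqP; rewrite eq_le; apply/andP.
Qed.

(** Up to a positive factor [v A] is a difference of two points of LIP, and LIP lies in [V] because
    zero distance forces equal coordinates. *)
Lemma vsplit_flatV A : A \in S -> (v A <= V)%MS.
Proof.
move=> AS; have AZ : A \in Z (cell v S 0) by rewrite zeros_cell0.
have := addmx_sub (LIP_flatV (sface_LIP (sface_shift true AZ)))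
  (_ : (- center (cell v S 0) <= V)%MS).
rewrite eqmx_opp scale1r addrAC subrr add0r => /(_ (LIP_flatV (center_LIP _))).
by move/(scalemx_sub (alpha A)^-1); rewrite scalerA mulVf ?scale1r ?lt0r_neq0 ?alpha_gt0.
Qed.

Lemma fvec_LIP :
  fvec (LIP d) r.+1 (fun k => if k is k'.+1 then
    #|[set s in [set s | realized v S s] | \rank (vspan v (Z s)) == k']| else 1%N).
Proof.
have SV := vsplit_flatV.
split.
  rewrite intS addrC addKr (rkAE SV) -zeros_cell0.
  exact: affdim_ext LIP_sface0 (affdim_sface _).
move=> [|k] kD.
  rewrite sub0r -(cards1 tt); apply: (@nfaces_card _ _ _ _ _ _ (fun=> fun=> False)).
  - move=> _ _; split; last by left; split=> [|x []].
    (* The empty face is cut out by the valid inequality 0 <= 1. *)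
    exists 0, 1; split=> y; first by rewrite dot0l ler01.
    by split=> // -[_]; rewrite dot0l => /esym/eqP; rewrite oner_eq0.
  - by move=> [] [].
  move=> F _ [[_ F0]|[m [//]]]; exists tt; first by rewrite inE.
  by move=> x; split=> // /F0.
rewrite intS addrC addKr; apply: (nfaces_card (Phi := sface)).
- move=> s; rewrite !inE => /andP[/realizedP[c ->] /eqP <-].
  split; last exact: affdim_sface.
  by exists c, (support_fun c); split=> y; [apply: dot_LIP_le | apply: sfaceP].
- move=> s s'; rewrite !inE => /andP[rs _] /andP[rs' _] ss'.
  apply: center_max_inj => // c E.
    have := (ss' _).2 (center_sface s'); by rewrite E => /sfaceP[].
  have := (ss' _).1 (center_sface s); by rewrite E => /sfaceP[].
move=> F hF aF; have [s rs Fs] := LIP_face hF aF; exists s => //.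
rewrite !inE rs /=; apply/eqP.
by have [] := affdim_uniq (affdim_ext Fs aF) (affdim_sface s).
Qed.

(** In [Mob_eval] at u = -1/t the signs (-1)^r cancel and a cell of rank k contributes t^(r - k),
    the weight of a face of dimension k; the empty face gives t^(r+1). *)
Lemma fpoly_LIP (t : R) : t != 0 ->
  fpoly_val r.+1 (fun k => if k is k'.+1 then
    #|[set s in [set s | realized v S s] | \rank (vspan v (Z s)) == k']| else 1%N) t
  = (- t) ^+ r * Mob d S (- t^-1) (-1) + t ^+ r.+1.
Proof.
move=> t0; have SV := vsplit_flatV.
rewrite /fpoly_val big_ord_recl subn0 mul1r addrC; congr (_ + _).
rewrite (sum_card_fiber (fun k => t ^+ (r.+1 - k.+1))) => [|s _]; last first.
  by rewrite ltnS rank_span_le ?zeros_sub.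
rewrite (Mob_eval SV) mulrA -exprMn mulrN1 opprK mulr_sumr big_set /=.
apply: eq_bigr => s _; rewrite subSS opprK exprVn.
by rewrite expfB_cond // (negPf t0) rank_span_le ?zeros_sub.
Qed.

End LipFaces.

(** The hyperplane misses the origin, so passing from linear to affine span loses one dimension;
    without generators the set is empty, in accordance with the value -1. *)
Lemma affdim_hyperplane (R : realFieldType) (n : nat) (T : finType) (g : T -> 'rV[R]_n)
    (P : 'rV[R]_n -> Prop) (Z : {set T}) y :
  (forall x, P x -> dot y x = 1 /\ (x <= vspan g Z)%MS) ->
  (forall a, a \in Z -> P (g a)) ->
  affdim P ((\rank (vspan g Z))%:Z - 1).
Proof.
move=> Py Pg; have [Z0|[a0 a0Z]] := set_0Vmem Z.
  have s0 : vspan g Z = 0 by rewrite Z0 /vspan big_set0.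
  rewrite s0 mxrank0 sub0r; left; split=> // x /Py[yx]; rewrite s0 submx0 => /eqP x0.
  by move/eqP: yx; rewrite x0 dot0r eq_sym oner_eq0.
pose h a := g a - g a0.
have y1 a : a \in Z -> dot y (g a) = 1 by move/Pg/Py => [].
have hy : (vspan h Z <= kermx y^T)%MS.
  by apply/vspan_perpP => a aZ; rewrite dotBr !y1 ?subrr.
have g0 : (g a0 <= vspan g Z)%MS by rewrite vspan_mem.
have hS : (vspan h Z <= vspan g Z)%MS.
  by apply/vspan_subP => a aZ; rewrite addmx_sub ?eqmx_opp ?vspan_mem.
have y0 : dot y (g a0) != 0 by rewrite y1 ?oner_neq0.
have sg : (vspan g Z <= g a0 + vspan h Z)%MS.
  apply/vspan_subP => a aZ; rewrite -[g a](subrK (g a0)) addrC addmx_sub_adds //.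
  exact: (vspan_mem h).
have rE : \rank (vspan g Z) = (\rank (vspan h Z)).+1.
  have -> : \rank (vspan g Z) = \rank (g a0 + vspan h Z)%MS.
    by apply: eqmx_rank; rewrite sg addsmx_sub g0.
  rewrite mxrank_disjoint_sum ?rank_rV; last first.
    apply/eqP; rewrite -submx0; apply/row_subP => i; set x := row i _.
    have : (x <= g a0 :&: vspan h Z)%MS by apply: row_sub.
    rewrite sub_capmx => /andP[/sub_rVP[k ->]] /dot_sub /(_ hy).
    rewrite dotZr => /eqP; rewrite mulf_eq0 (negPf y0) orbF => /eqP->.
    by rewrite scale0r sub0mx.
  by have -> : g a0 != 0 by apply: contraNneq y0 => ->; rewrite dot0r.
rewrite rE intS addrC addKr; apply: (affdim_family (p0 := g a0)); first exact: Pg.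
  by move=> a aZ; rewrite addrC subrK; apply: Pg.
move=> q /Py[yq /submxP[D qD]].
have qg : (q <= vspan g Z)%MS by apply/submxP; exists D.
have /sub_addsmxP[[u w] /= qE] := submx_trans qg sg.
(* Pairing with [y] kills the differences and reads off the coefficient of [g a0]. *)
have u1 : u = 1%:M.
  have := yq; rewrite qE dotDr [dot y (w *m _)](dot_sub _ hy) ?submxMl // addr0.
  rewrite [u]mx11_scalar mul_scalar_mx dotZr y1 // mulr1 => -> //.
by rewrite qE u1 mul1mx addrC addKr submxMl.
Qed.

(** * Faces of the fundamental polytope *)

Section PdFaces.
Variables (R : realFieldType) (n : nat) (d : 'I_n -> 'I_n -> R).
Variables (alpha : {set 'I_n} -> R) (S : {set {set 'I_n}}).
Local Notation v := (@vsplit R n).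
Local Notation V := (flatV d).
Local Notation r := (rkA d S).
Local Notation sign := {ffun {set 'I_n} -> option bool}.
Local Notation Z s := (zeros S s).
Local Notation center := (center alpha S).
Local Notation support_fun := (support_fun alpha S).
Hypothesis alpha_gt0 : forall A, A \in S -> 0 < alpha A.
Hypothesis Sne : forall A, A \in S -> A != set0 /\ ~: A != set0.
Hypothesis pc : pairwise_compatible S.
Hypothesis dE : forall i j, d i j = splitd alpha S i j.
Implicit Types (c x y w : 'rV[R]_n) (s : sign).

Let SV := vsplit_flatV alpha_gt0 Sne pc dE.

Lemma LIP_perturb y w : LIP d y -> (w <= V)%MS ->
  (forall i j, i != j -> y 0 i - y 0 j = d i j -> w 0 i = w 0 j) ->
  exists2 eps, 0 < eps & LIP d (y + eps *: w).
Proof.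
move=> [y0 yd] /flatVP[w0 _] hw.
have [eps eps0 small] := small_step
  (fun p : 'I_n * 'I_n => d p.1 p.2 - (y 0 p.1 - y 0 p.2)) (fun p => w 0 p.1 - w 0 p.2).
exists eps => //; split.
  under eq_bigr => i _ do rewrite !mxE.
  by rewrite big_split /= y0 -mulr_sumr w0 mulr0 addr0.
move=> i j; rewrite !mxE.
have [<-|ij] := eqVneq i j; first by rewrite subrr; have := yd i i; rewrite subrr.
have -> : y 0 i + eps * w 0 i - (y 0 j + eps * w 0 j) =
  (y 0 i - y 0 j) + eps * (w 0 i - w 0 j) by ring.
have [E|slack] := eqVneq (d i j - (y 0 i - y 0 j)) 0.
  have e : y 0 i - y 0 j = d i j by apply/esym/eqP; rewrite -subr_eq0 E.
  by rewrite (hw i j ij e) subrr mulr0 addr0.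
have := small (i, j) slack; rewrite /= [`|d _ _ - _|]ger0_norm ?subr_ge0 // ltr_norml.
by move=> /andP[_] /ltW; rewrite lerBrDl.
Qed.

(** Both [w] and [- w] are feasible directions at the centre, where a normal [c] of the face is
    maximal; so [c] is orthogonal to [w], and the perturbed point stays in the face. *)
Lemma tight_span s w : realized v S s -> (w <= V)%MS ->
  (forall i j, i != j -> center s 0 i - center s 0 j = d i j -> w 0 i = w 0 j) ->
  (w <= vspan v (Z s))%MS.
Proof.
move=> /realizedP[c sc] wV hw.
have cL := center_LIP alpha_gt0 Sne pc dE s.
have [e e0 he] := LIP_perturb cL wV hw.
have nwV : (- w <= V)%MS by rewrite eqmx_opp.
have [e' e0' he'] : exists2 e, 0 < e & LIP d (center s + e *: - w).
  by apply: LIP_perturb => // i j ij /(hw i j ij); rewrite !mxE => ->.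
have := dot_LIP_le alpha_gt0 Sne pc dE c he.
have := dot_LIP_le alpha_gt0 Sne pc dE c he'.
have cs : dot c (center s) = support_fun c by rewrite sc (dot_center alpha_gt0 Sne pc dE).
rewrite !dotDr !dotZr dotNr cs !gerDl => h1 h2.
have cw : dot c w = 0 by apply/eqP; rewrite eq_le; apply/andP; split; nra.
have hF : sface alpha S s (center s + e *: w).
  by rewrite sc; apply/(sfaceP alpha_gt0 Sne pc dE); rewrite -sc dotDr dotZr cw mulr0 addr0 cs.
have := sface_diff hF (center_sface alpha_gt0 s).
rewrite addrAC subrr add0r => /(scalemx_sub e^-1).
by rewrite scalerA mulVf ?scale1r ?gt_eqF.
Qed.

(** The zero sign vector has centre 0, where the tight pairs are those at distance 0, and vectors of
    [V] are constant along these. *)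
Lemma flatV_span : (V <= vspan v S)%MS.
Proof.
apply/row_subP => i; rewrite -(@zeros_cell0 R n S).
apply: tight_span; first by apply/realizedP; exists 0.
  exact: row_sub.
have c0 : center (cell v S 0) = 0.
  by apply: big1 => A AS; rewrite ffunE AS dot0l /sgb eqxx /= mulr0 scale0r.
move=> j k _; rewrite c0 !mxE subrr => /esym djk.
by have /flatVP[_ /(_ j k djk)] := row_sub i V; rewrite !mxE.
Qed.

Lemma rank_flatV : \rank V = r.
Proof.
rewrite (rkAE SV); apply/eqP; rewrite eqn_leq (mxrankS flatV_span) /=.
by apply/mxrankS/(vspan_sub_flatV SV).
Qed.

Hypothesis dmetric : is_metric d.

(** The generators of [Pd]; some of them may fail to be vertices, for instance when a third point
    lies between the two. *)
Definition vertex (p : 'I_n * 'I_n) : 'rV[R]_n := (d p.1 p.2)^-1 *: (evec R p.1 - evec R p.2).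
Definition tight y : {set 'I_n * 'I_n} :=
  [set p | (p.1 != p.2) && (y 0 p.1 - y 0 p.2 == d p.1 p.2)].
Definition pface y x : Prop := Pd d x /\ dot y x = 1.

Lemma dot_vertex y p : dot y (vertex p) = (d p.1 p.2)^-1 * (y 0 p.1 - y 0 p.2).
Proof. by rewrite dotZr dotBr !dot_evec. Qed.

Lemma Pd_vertex p : p.1 != p.2 -> Pd d (vertex p).
Proof.
case: p => i j /= ij.
exists (fun k l => ((k == i) && (l == j))%:R).
have single (U : nmodType) (F : 'I_n -> 'I_n -> U) :
    (forall k l, (k != i) || (l != j) -> F k l = 0) -> \sum_k \sum_l F k l = F i j.
  move=> h; rewrite (bigD1 i) //= [X in _ + X]big1 ?addr0 => [|k ki]; last first.
    by apply: big1 => l _; rewrite h // ki.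
  by rewrite (bigD1 j) //= big1 ?addr0 // => l lj; rewrite h // lj orbT.
split=> [k l|k||].
- by rewrite ler0n.
- by case: eqP => // ->; rewrite (negPf ij).
- rewrite (single _ (fun k l => ((k == i) && (l == j))%:R)) ?eqxx // => k l.
  by rewrite -negb_and => /negPf->.
rewrite single ?eqxx ?scale1r // => k l.
by rewrite -negb_and => /negPf->; rewrite scale0r.
Qed.

Lemma dot_Pd y (lam : 'I_n -> 'I_n -> R) :
  dot y (\sum_i \sum_j lam i j *: vertex (i, j)) =
  \sum_i \sum_j lam i j * ((d i j)^-1 * (y 0 i - y 0 j)).
Proof.
rewrite dot_sumr; apply: eq_bigr => i _; rewrite dot_sumr; apply: eq_bigr => j _.
by rewrite dotZr dot_vertex.
Qed.

Lemma Pd_term y (lam : 'I_n -> 'I_n -> R) i j : LIP d y -> 0 <= lam i j -> lam i i = 0 ->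
  lam i j * ((d i j)^-1 * (y 0 i - y 0 j)) <= lam i j.
Proof.
move=> [_ yd] l0 li; have [<-|ij] := eqVneq i j; first by rewrite li mul0r.
rewrite ler_piMr // mulrC ler_pdivrMr ?dmetric // mul1r; exact: yd.
Qed.

Lemma Pd_le1 y x : LIP d y -> Pd d x -> dot y x <= 1.
Proof.
move=> yL [lam [l0 li l1 ->]]; rewrite dot_Pd -l1.
by apply: ler_sum => i _; apply: ler_sum => j _; apply: Pd_term.
Qed.

(** Each term of [dot y x] is at most its weight and the weights sum to 1, so equality confines the
    weights to tight pairs. *)
Lemma pface_span y x : LIP d y -> pface y x -> (x <= vspan vertex (tight y))%MS.
Proof.
move=> yL [[lam [l0 li l1 ->]]]; rewrite dot_Pd -l1 !pair_big /= => E.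
apply: summx_sub => -[i j] _ /=.
have := eq_of_eq_sum (S := [set: 'I_n * 'I_n]) (G := fun p => lam p.1 p.2)
  (F := fun p => lam p.1 p.2 * ((d p.1 p.2)^-1 * (y 0 p.1 - y 0 p.2))).
move=> /(_ _ _ (i, j) (in_setT _)) /= h.
have {h} : lam i j * ((d i j)^-1 * (y 0 i - y 0 j)) = lam i j.
  apply: h => [p _|]; first exact: Pd_term.
  by rewrite (eq_bigl predT) => [|p]; rewrite ?inE // E; apply: eq_bigl => p; rewrite inE.
have [->|lij] := eqVneq (lam i j) 0; first by rewrite scale0r sub0mx.
move=> h; apply/scalemx_sub/(@vspan_mem _ _ _ vertex _ (i, j)).
have ij : i != j by apply: contraNneq lij => <-; rewrite li.
rewrite inE /= ij /=; apply/eqP/(mulfI (invr_neq0 (lt0r_neq0 (dmetric ij)))).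
by rewrite mulVf ?lt0r_neq0 ?dmetric //; apply: (mulfI lij); rewrite h mulr1.
Qed.

Lemma pface_vertex y p : p \in tight y -> pface y (vertex p).
Proof.
rewrite inE => /andP[pp /eqP e]; split; first exact: Pd_vertex.
by rewrite dot_vertex e mulVf ?gt_eqF ?dmetric.
Qed.

Lemma tight_vertex y p : p.1 != p.2 -> dot y (vertex p) = 1 -> p \in tight y.
Proof.
move=> pp; rewrite inE pp dot_vertex => e.
apply/eqP/(mulfI (invr_neq0 (lt0r_neq0 (dmetric pp)))).
by rewrite e mulVf ?lt0r_neq0 ?dmetric.
Qed.

Lemma flatV_metricP x : (x <= V)%MS <-> \sum_i x 0 i = 0.
Proof.
split=> [/flatVP[]//|x0]; apply/flatVP; split=> // i j dij.
by have [->//|/dmetric] := eqVneq i j; rewrite dij ltxx.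
Qed.

Lemma vertex_flatV p : (vertex p <= V)%MS.
Proof.
apply/scalemx_sub/flatV_metricP.
have e i : \sum_k evec R i 0 k = 1.
  by rewrite (bigD1 i) //= mxE eqxx big1 ?addr0 // => k /negPf ki; rewrite mxE ki.
transitivity (\sum_k (evec R p.1 0 k - evec R p.2 0 k)); last by rewrite sumrB !e subrr.
by apply: eq_bigr => k _; rewrite !mxE.
Qed.

Lemma vspan_vertex_flatV Y : (vspan vertex Y <= V)%MS.
Proof. by apply/vspan_subP => p _; apply: vertex_flatV. Qed.

(** Orthogonality to the tight generators means constancy along tight pairs, so [tight_span] gives
    one inclusion. For the other, a tight pair cannot see [v A] with zero sign, since the centre
    moves along it both ways inside LIP. *)
Lemma rank_tight s : realized v S s ->
  (\rank (vspan vertex (tight (center s))) = r - \rank (vspan v (Z s)))%N.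
Proof.
move=> rs; rewrite -rank_flatV -(rank_perp (vspan_vertex_flatV (tight (center s)))).
suff -> : \rank (V :&: kermx (vspan vertex (tight (center s)))^T)%MS = \rank (vspan v (Z s)).
  by rewrite addKn.
apply: eqmx_rank; apply/andP; split.
  apply/row_subP => i; set w := row i _.
  have : (w <= V :&: kermx (vspan vertex (tight (center s)))^T)%MS by apply: row_sub.
  rewrite sub_capmx => /andP[wV]; rewrite sub_kermx_tr => /vspan_perpP hw.
  apply: tight_span => // j k jk e.
  have /hw : (j, k) \in tight (center s) by rewrite inE /= jk e eqxx.
  rewrite dot_vertex /= => /eqP; rewrite mulf_eq0 invr_eq0 gt_eqF ?dmetric //= subr_eq0.
  by move/eqP.
rewrite sub_capmx (vspan_sub_flatV SV (zeros_sub _ _)) /= sub_kermx_tr.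
apply/vspan_subP => -[i j]; rewrite inE /= => /andP[ij /eqP e].
rewrite sub_kermx_tr; apply/vspan_subP => A AZ; apply/sub_perpP.
rewrite dotC dot_vertex /= .
have AS : A \in S by move: AZ; rewrite inE => /andP[].
have := (sface_LIP alpha_gt0 Sne pc dE (sface_shift alpha_gt0 true AZ)).2 i j.
have := (sface_LIP alpha_gt0 Sne pc dE (sface_shift alpha_gt0 false AZ)).2 i j.
rewrite -e /= !mxE -/(v A) => h1 h2; apply/eqP; rewrite mulf_eq0; apply/orP; right.
have a0 := alpha_gt0 AS; rewrite eq_le; apply/andP; split; nra.
Qed.

(** The zero sign vector is included: its centre is 0, the face is empty, and the formula gives
    -1. *)
Lemma affdim_pface s : realized v S s ->
  affdim (pface (center s)) ((r - \rank (vspan v (Z s)))%N%:Z - 1).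
Proof.
move=> rs; rewrite -rank_tight //; apply: (@affdim_hyperplane _ _ _ _ _ _ (center s)).
  move=> x hx; split; first by case: hx.
  by apply: pface_span hx; apply: center_LIP.
by move=> p; apply: pface_vertex.
Qed.

(** Equal faces have equal tight pairs, so LIP contains a point slightly beyond [center u] on the
    line from [center u']. A functional maximal at [center u] is therefore maximal at [center u']
    too. *)
Lemma pface_inj s s' : realized v S s -> realized v S s' ->
  (forall x, pface (center s) x <-> pface (center s') x) -> s = s'.
Proof.
have half u u' : realized v S u -> realized v S u' ->
    (forall x, pface (center u) x <-> pface (center u') x) ->
    forall c, u = cell v S c -> dot c (center u') = support_fun c.
  move=> ru ru' E c uc.
  have uL := center_LIP alpha_gt0 Sne pc dE u.
  have uL' := center_LIP alpha_gt0 Sne pc dE u'.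
  have wV : (center u - center u' <= V)%MS.
    by rewrite addmx_sub ?eqmx_opp ?(LIP_flatV dE).
  have [i j ij|e e0 he] := LIP_perturb uL wV.
    move=> tij; have pt : (i, j) \in tight (center u) by rewrite inE /= ij tij eqxx.
    have /E[_ /tight_vertex] := pface_vertex pt; rewrite inE ij /= => /(_ isT)/eqP.
    by rewrite -tij !mxE => h; lra.
  have := dot_LIP_le alpha_gt0 Sne pc dE c he.
  have := dot_LIP_le alpha_gt0 Sne pc dE c uL'.
  have cu : dot c (center u) = support_fun c by rewrite uc (dot_center alpha_gt0 Sne pc dE).
  rewrite dotDr dotZr dotBr cu gerDl => h1 h2; apply/eqP; rewrite eq_le h1 /=.
  by rewrite -subr_le0 -(pmulr_rle0 _ e0).
move=> rs rs' E; apply: (center_max_inj alpha_gt0) => //; apply: half => // x.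
by split=> /E.
Qed.

Lemma support_Pd x : Pd d x -> support_fun x <= 1.
Proof.
move=> xP; rewrite -(dot_center alpha_gt0 Sne pc dE) dotC.
by apply: Pd_le1 => //; apply: center_LIP.
Qed.

Lemma support_funD c x : support_fun (c + x) <= support_fun c + support_fun x.
Proof.
rewrite -big_split /=; apply: ler_sum => A AS; rewrite -mulrDr dotDl.
by rewrite ler_wpM2l ?ler_normD // ltW ?alpha_gt0.
Qed.

(* A normal vector [c] of LIP at [y] with the most nonzero signs lies in the relative
   interior of the normal cone, so no normal vector at [y] can disagree with its signs. *)
Lemma max_normal y : LIP d y -> exists2 c, dot c y = support_fun c &
  forall x, dot x y = support_fun x ->
  forall A, A \in S -> dot x (v A) != 0 -> cell v S c A = cell v S x A.
Proof.
move=> yL; have [a a1 yE] := (LIP_zonotopeP alpha_gt0 Sne pc dE y).1 yL.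
pose normal s := `[< exists2 c, s = cell v S c & dot c y = support_fun c >].
have n0 : normal (cell v S 0).
  apply/asboolP; exists 0; rewrite // dot0l; apply/esym/big1 => A _.
  by rewrite dot0l normr0 mulr0.
case: (arg_maxnP (fun s : sign => #|[set A in S | s A != None]|) n0) => s /asboolP[c sc cy] mx.
exists c => // x xy A AS xA.
have av z : dot z y = support_fun z -> forall B, B \in S -> cell v S z B != None ->
    a B = alpha B * sv (cell v S z B).
  by rewrite yE => h B BS zB; apply: (dot_comb_max z a1).1 h B BS zB.
have same B : B \in S -> cell v S c B != None -> cell v S x B != None ->
    cell v S c B = cell v S x B.
  move=> BS cB xB; apply: (@sv_inj R); apply: (mulfI (lt0r_neq0 (alpha_gt0 BS))).
  by rewrite -(av c) // -(av x).
have ncx : normal (cell v S (c + x)).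
  apply/asboolP; exists (c + x) => //; apply/eqP; rewrite eq_le.
  by rewrite (dot_LIP_le alpha_gt0 Sne pc dE) //= dotDl cy xy support_funD.
have xN B : B \in S -> (cell v S x B != None) = (dot x (v B) != 0).
  by move=> BS; rewrite ffunE BS sgb0.
have cN B : B \in S -> (cell v S c B != None) = (dot c (v B) != 0).
  by move=> BS; rewrite ffunE BS sgb0.
have [cA|cA] := boolP (cell v S c A != None); first by rewrite same // xN.
(* If [c] vanished on [v A], the normal [c + x] would keep all nonzero signs of [c] and gain the one
   at [A]. *)
have := mx _ ncx; rewrite /geq /= leqNgt => /negP; case; apply: proper_card; apply/properP; split.
  apply/subsetP => B; rewrite !inE => /andP[BS]; rewrite BS /= sc => cB.
  have [xB|xB] := eqVneq (dot x (v B)) 0.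
    by move: cB; rewrite !ffunE BS dotDl xB addr0.
  have := same B BS cB; rewrite xN // => /(_ xB); rewrite !ffunE BS dotDl => e.
  have := @sgb_convex R (dot c (v B)) (dot x (v B)) 1 1 _ ltr01 ltr01 erefl (esym e).
  by rewrite !mul1r => ->; move: cB; rewrite ffunE BS.
move: cA; rewrite cN // negbK => /eqP cA.
exists A; rewrite !inE AS ?sc /= ffunE AS sgb0 ?dotDl cA ?add0r ?eqxx //.
Qed.

(** As [support_fun x] is at most 1 on [Pd], [dot y x = 1] makes [x] a normal of LIP at [y]; its
    signs then agree with those of the maximal normal [c]. Conversely, an [x] maximal at the centre
    only involves coefficients that [c] has already fixed in [y]. *)
Lemma pface_center y : LIP d y -> exists2 s, realized v S s &
  forall x, Pd d x -> (dot y x = 1 <-> dot (center s) x = 1).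
Proof.
move=> yL; have [a a1 yE] := (LIP_zonotopeP alpha_gt0 Sne pc dE y).1 yL.
have [c cy mx] := max_normal yL.
exists (cell v S c); first by apply/realizedP; exists c.
move=> x xP; have x1 := support_Pd xP.
have cL := center_LIP alpha_gt0 Sne pc dE (cell v S c).
split=> h.
  have xy : dot x y = support_fun x.
    apply/eqP; rewrite eq_le (dot_LIP_le alpha_gt0 Sne pc dE) //=.
    by rewrite dotC h.
  rewrite -h [RHS]dotC xy -(dot_center alpha_gt0 Sne pc dE) dotC !dot_comb.
  apply: eq_bigr => A AS; have [->|xA] := eqVneq (dot x (v A)) 0; first by rewrite !mulr0.
  by rewrite (mx x xy A AS xA).
have xs : dot x (center (cell v S c)) = support_fun x.
  apply/eqP; rewrite eq_le (dot_LIP_le alpha_gt0 Sne pc dE) //=.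
  by rewrite dotC h.
have sc1 : support_fun x = 1 by rewrite -xs dotC.
rewrite dotC yE -sc1; apply/(dot_comb_max x a1) => A AS xA.
have e := center_max alpha_gt0 xs AS xA.
rewrite -e; have cA : cell v S c A != None by rewrite e.
by move: cy; rewrite yE => /(dot_comb_max c a1) /(_ A AS cA).
Qed.

Hypothesis n_gt1 : (1 < n)%N.

Let two_points : exists p : 'I_n * 'I_n, p.1 != p.2.
Proof.
exists (Ordinal (ltnW n_gt1), Ordinal n_gt1).
by rewrite -val_eqE.
Qed.

(** The midpoint of two opposite generators; with a single point there would be none and [Pd] would
    be empty. *)
Lemma Pd0 : Pd d 0.
Proof.
have [[i j] /= ij] := two_points.
have [lam [l0 li l1 lE]] := Pd_vertex (p := (i, j)) ij.
have ji : j != i by rewrite eq_sym.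
have [mu [m0 mi m1 mE]] := Pd_vertex (p := (j, i)) ji.
exists (fun k l => 2^-1 * (lam k l + mu k l)); split.
- by move=> k l; rewrite mulr_ge0 ?addr_ge0 // invr_ge0 ler0n.
- by move=> k; rewrite li mi addr0 mulr0.
- under eq_bigr => k _ do rewrite -mulr_sumr big_split /=.
  by rewrite -mulr_sumr big_split /= l1 m1; field.
transitivity (2^-1 *: (vertex (i, j) + vertex (j, i))).
  rewrite /vertex /= (splitd_symm dE j i) -scalerDr addrC subrKA subrr !scaler0 //.
rewrite lE mE -big_split scaler_sumr; apply: eq_bigr => k _ /=.
rewrite -big_split scaler_sumr; apply: eq_bigr => l _ /=.
by rewrite -scalerDl scalerA.
Qed.

Lemma Pd_flatV x : Pd d x -> (x <= V)%MS.
Proof.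
move=> [lam [_ _ _ ->]]; apply: summx_sub => i _; apply: summx_sub => j _.
exact/scalemx_sub/(vertex_flatV (i, j)).
Qed.

Lemma affdim_Pd : affdim (Pd d) r%:Z.
Proof.
pose E : {set 'I_n * 'I_n} := [set p | p.1 != p.2].
have const w : (w <= V)%MS -> (w <= kermx (vspan vertex E)^T)%MS -> w = 0.
  move=> /flatV_metricP w0; rewrite sub_kermx_tr => /vspan_perpP hw.
  apply/rowP => i; rewrite mxE.
  have wi j : w 0 j = w 0 i.
    have [->//|ij] := eqVneq i j.
    have /hw : (i, j) \in E by rewrite inE.
    rewrite dot_vertex /= => /eqP; rewrite mulf_eq0 invr_eq0 gt_eqF ?dmetric //= subr_eq0.
    by move/eqP.
  move: w0; rewrite (eq_bigr (fun=> w 0 i)) // sumr_const card_ord => /eqP.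
  by rewrite mulrn_eq0 => /orP[/eqP n0|/eqP//]; have := ltn_ord i; rewrite {2}n0.
have rE : \rank (vspan vertex E) = r.
  rewrite -rank_flatV -(rank_perp (vspan_vertex_flatV E)).
  suff -> : (V :&: kermx (vspan vertex E)^T)%MS = 0 by rewrite mxrank0.
  apply/eqP; rewrite -submx0; apply/row_subP => i; set w := row i _.
  have : (w <= V :&: kermx (vspan vertex E)^T)%MS by apply: row_sub.
  by rewrite sub_capmx => /andP[wV wE]; rewrite (const w) ?sub0mx.
rewrite -rE; apply: (affdim_family Pd0).
  by move=> p; rewrite inE add0r => /Pd_vertex.
move=> q [lam [_ li _ ->]]; rewrite subr0.
apply: summx_sub => i _; apply: summx_sub => j _.
have [<-|ij] := eqVneq i j; first by rewrite li scale0r sub0mx.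
by apply/scalemx_sub/(@vspan_mem _ _ _ vertex E (i, j)); rewrite inE.
Qed.

Lemma is_face_pface y : LIP d y -> is_face (Pd d) (pface y).
Proof. by move=> yL; exists y, 1; split=> [x|x]; [apply: Pd_le1 | split]. Qed.

Lemma is_face_Pd : is_face (Pd d) (Pd d).
Proof.
exists 0, 0; split=> x; first by rewrite dot0l.
by rewrite dot0l; split=> [|[]].
Qed.

(** Opposite generators force [b >= 0]. If [b = 0] then [c] is constant and cuts out everything;
    otherwise [c] rescaled by [b] becomes a point of LIP. *)
Lemma Pd_face F : is_face (Pd d) F ->
  (forall x, F x <-> Pd d x) \/
  exists2 s, realized v S s & forall x, F x <-> pface (center s) x.
Proof.
move=> [c [b [cb hF]]].
have cd i j : i != j -> c 0 i - c 0 j <= b * d i j.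
  move=> ij; have := cb _ (Pd_vertex (p := (i, j)) ij).
  by rewrite dot_vertex /= mulrC ler_pdivrMr ?dmetric.
have b0 : 0 <= b.
  have [[i j] /= ij] := two_points.
  have ji : j != i by rewrite eq_sym.
  have := cd i j ij; have := cd j i ji; rewrite (splitd_symm dE j i).
  by have := dmetric ij; nra.
have [b00|bn0] := eqVneq b 0.
  left=> x; rewrite hF; split=> [[]//|xP]; split=> //.
  case: xP => lam [_ _ _ ->]; rewrite dot_Pd b00.
  apply: big1 => i _; apply: big1 => j _; have [<-|ij] := eqVneq i j.
    by rewrite subrr !mulr0.
  have ji : j != i by rewrite eq_sym.
  have := cd i j ij; have := cd j i ji; rewrite b00 !mul0r => h1 h2.
  have -> : c 0 i - c 0 j = 0 by lra.
  by rewrite !mulr0.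
have bp : 0 < b by rewrite lt0r bn0.
pose m := (\sum_i c 0 i) / n%:R.
(* Subtracting the mean achieves sum zero without changing the pairing with [Pd], whose points have
   coordinate sum zero. *)
pose y : 'rV[R]_n := b^-1 *: (c - const_mx m).
have nn : n%:R != 0 :> R by rewrite pnatr_eq0 -lt0n ltnW.
have yL : LIP d y.
  split.
    transitivity (b^-1 * \sum_i (c 0 i - m)).
      by rewrite mulr_sumr; apply: eq_bigr => i _; rewrite !mxE.
    rewrite sumrB sumr_const card_ord -[X in _ - X]mulr_natr mulfVK //.
    by rewrite subrr mulr0.
  move=> i j; have [<-|ij] := eqVneq i j.
    by rewrite subrr dE splitd_ge0 // => A /alpha_gt0/ltW.
  have -> : y 0 i - y 0 j = b^-1 * (c 0 i - c 0 j) by rewrite !mxE; ring.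
  by rewrite mulrC ler_pdivrMr // mulrC cd.
have yx x : Pd d x -> dot y x = b^-1 * dot c x.
  move=> /Pd_flatV/flatVP[x0 _]; rewrite dotZl [dot (c - _) x]dotC dotBr !(dotC x).
  have -> : dot (const_mx m) x = m * \sum_i x 0 i.
    by rewrite mulr_sumr; apply: eq_bigr => i _; rewrite mxE.
  by rewrite x0 mulr0 subr0.
have [s rs hs] := pface_center yL.
right; exists s => // x; rewrite hF; split=> -[xP hx]; split=> //.
  by apply/(hs x xP); rewrite yx // hx mulVf.
have /(hs x xP) := hx; rewrite yx // => e.
by apply: (mulfI (invr_neq0 bn0)); rewrite e mulVf.
Qed.

Lemma fvec_Pd :
  fvec (Pd d) r.+1 (fun k => if k == r.+1 then 1%N else
    #|[set s in [set s | realized v S s] | (r - \rank (vspan v (Z s)))%N == k]|).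
Proof.
split; first by rewrite intS addrC addKr; apply: affdim_Pd.
move=> k kD; have [->|kr] := eqVneq k r.+1.
  rewrite intS addrC addKr -(cards1 tt).
  apply: (@nfaces_card _ _ _ _ _ _ (fun=> Pd d)).
  - by move=> _ _; split; [apply: is_face_Pd | apply: affdim_Pd].
  - by move=> [] [].
  move=> F /Pd_face[FP _|[s rs Fs] aF]; first by exists tt; rewrite ?inE.
  have := affdim_uniq (affdim_ext Fs aF) (affdim_pface rs).
  have := leq_subr (\rank (vspan v (Z s))) r; lia.
apply: (nfaces_card (Phi := fun s => pface (center s))).
- move=> s; rewrite !inE => /andP[rs /eqP <-]; split; last exact: affdim_pface.
  by apply/is_face_pface/center_LIP.
- by move=> s s'; rewrite !inE => /andP[rs _] /andP[rs' _]; apply: pface_inj.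
move=> F /Pd_face[FP aF|[s rs Fs] aF].
  by have := affdim_uniq (affdim_ext FP aF) affdim_Pd; lia.
exists s => //; rewrite !inE rs /=; apply/eqP.
by have := affdim_uniq (affdim_ext Fs aF) (affdim_pface rs); lia.
Qed.

(** A sign vector of rank k is a face of dimension r - k - 1 and so has weight t^(k+1), which
    explains the factor t; the final 1 is [Pd] itself. *)
Lemma fpoly_Pd (t : R) :
  fpoly_val r.+1 (fun k => if k == r.+1 then 1%N else
    #|[set s in [set s | realized v S s] | (r - \rank (vspan v (Z s)))%N == k]|) t
  = (-1) ^+ r * Mob d S (- t) (-1) * t + 1.
Proof.
rewrite /fpoly_val big_ord_recr /= eqxx subnn expr0 mulr1; congr (_ + _).
transitivity (\sum_(k < r.+1) #|[set s in [set s | realized v S s] |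
    (r - \rank (vspan v (Z s)))%N == k]|%:R * t ^+ (r.+1 - k)).
  by apply: eq_bigr => k _; rewrite ltn_eqF.
rewrite (sum_card_fiber (fun k => t ^+ (r.+1 - k))) => [|s _]; last first.
  by rewrite ltnS leq_subr.
rewrite (Mob_eval SV) mulrA -expr2 sqrr_sign mul1r mulr_suml big_set /=.
apply: eq_bigr => s _; rewrite opprK -exprSr.
by rewrite subSn ?leq_subr // subKn // rank_span_le ?zeros_sub.
Qed.

End PdFaces.

Unset Implicit Arguments.

Theorem mainTheorem5 (R : realFieldType) (n : nat) (d : 'I_n -> 'I_n -> R)
    (S : {set {set 'I_n}}) (alpha : {set 'I_n} -> R) :
  split_system S -> pairwise_compatible S ->
  (forall A, A \in S -> 0 < alpha A) ->
  (forall i j, d i j = \sum_(A in S) alpha A * (delta A i j)%:R) ->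
  (exists (D : nat) (f : nat -> nat), fvec (LIP d) D f /\
     forall t : R, t != 0 ->
       fpoly_val D f t
       = (- t) ^+ rkA d S * Mob d S (- t^-1) (-1) + t ^+ (rkA d S).+1)
  /\
  (is_metric d -> (1 < n)%N ->
   exists (D : nat) (f : nat -> nat), fvec (Pd d) D f /\
     forall t : R,
       fpoly_val D f t = (-1) ^+ rkA d S * Mob d S (- t) (-1) * t + 1).
Proof.
move=> ss pc alpha_gt0 dE.
have Sne A : A \in S -> A != set0 /\ ~: A != set0 by case/ss.
split.
  exists (rkA d S).+1; eexists; split.
    exact: (fvec_LIP alpha_gt0 Sne pc dE).
  by move=> t t0; apply: (fpoly_LIP alpha_gt0 Sne pc dE).
move=> dm n1; exists (rkA d S).+1; eexists; split.
  exact: (fvec_Pd alpha_gt0 Sne pc dE dm n1).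
by move=> t; apply: (fpoly_Pd alpha_gt0 Sne pc dE).
Qed.
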